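(* Let $0\le k\le n$, $n\ge1$. For Young diagrams $\lambda,\mu$ in the $k\times(n-k)$ rectangle, let $d_{\lambda,\mu}^\nu(\vec y)$ be the coefficients defined by the identity in $K_T(Gr(k,n))$ $$G_\lambda(\bar x;\vec y)\,G_\mu(\bar x;\overleftarrow{y})=\sum_\nu d_{\lambda,\mu}^\nu(\vec y)\,G_\nu(\bar x;\overleftarrow{y}),$$ where $\nu$ runs over Young diagrams in the $k\times(n-k)$ rectangle. Then $d_{\lambda,\mu}^\nu(\vec y)$ equals the sum of the modified weights of all equivariant puzzles in a down-pointing equilateral triangle of side $n$ whose boundary is as follows: the left side, read from the top-left corner to the bottom corner, encodes $\lambda$; the top horizontal side, read from right to left, encodes $\mu$; the right side, read from the top-right corner to the bottom corner, encodes $\nu$. Here the parameter of an elementary lozenge is $w=y_i/y_j$, where, numbering the unit edges of the top side $1,\dots,n$ from left to right, $i$ is the number of the top edge reached from the centre of the lozenge by going straight up-left (direction $120^\circ$), and $j$ is the number of the top edge reached from the centre by going straight up-right (direction $60^\circ$); thus $1\le i<j\le n$.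
   Context: **Young diagrams.** Fix $0\le k\le n$. A Young diagram $\lambda$ (English convention) in the $k\times(n-k)$ rectangle ($k$ rows, $n-k$ columns) is encoded by its frame, a $k$-subset of $\{1,\dots,n\}$: follow the border of $\lambda$ from the bottom-left to the top-right corner of the rectangle in $n$ unit steps (up or right), and record $i$ if the $i$-th step is up. So $\varnothing$ has frame $\{1,\dots,k\}$ and the full rectangle has frame $\{n-k+1,\dots,n\}$. Write $i\in\lambda$ if $i$ is in the frame of $\lambda$; $\lambda^\ast$ is the diagram with frame $\{n+1-i: i\in\lambda\}$. **Polynomials.** Let $\bar x=(x_1,\dots,x_k)$, $\vec y=(y_1,\dots,y_n)$, $\overleftarrow{y}=(y_n,\dots,y_1)$. The double Grothendieck polynomials $G^\lambda(\bar x;\vec y)$ are defined inductively by $G^{\{n-k+1,\dots,n\}}(\bar x;\vec y)=\prod_{i=1}^k\prod_{j=1}^{n-k}(1-x_i/y_j)$ and $G^\mu=D_iG^\lambda$ whenever the frame of $\mu$ is obtained from that of $\lambda$ by replacing $i+1$ with $i$, where $D_if=\dfrac{y_if(\ldots,y_i,y_{i+1},\ldots)-y_{i+1}f(\ldots,y_{i+1},y_i,\ldots)}{y_i-y_{i+1}}$ acts on the $y$ variables. The dual polynomials are $G_\lambda(\bar x;\vec y)=\prod_{i=1}^kx_i\prod_{i\in\lambda}y_i^{-1}\,G^{\lambda^\ast}(\bar x;\overleftarrow{y})$; $G_\lambda(\bar x;\overleftarrow{y})$ is obtained from it by substituting $y_i\mapsto y_{n+1-i}$. **Ring.** $K_T(Gr(k,n))$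 is the quotient of $\mathbb Z[x_1^{\pm1},\dots,x_k^{\pm1},y_1^{\pm1},\dots,y_n^{\pm1}]^{\mathcal S_k}$ ($\mathcal S_k$ permuting the $x_i$) by the ideal of elements that vanish whenever $(x_1,\dots,x_k)$ is specialized to $(y_{i_1},\dots,y_{i_k})$ for any $i_1<\dots<i_k$. It is known that the classes of the $G_\lambda(\bar x;\vec y)$ (equally, of the $G_\lambda(\bar x;\overleftarrow{y})$) form a $\mathbb Z[y_1^{\pm1},\dots,y_n^{\pm1}]$-basis. **Equivariant puzzles.** Consider the triangular lattice of unit equilateral triangles with horizontal edges. Each unit triangle has a horizontal edge $h$, an edge $a$ in direction $60^\circ/240^\circ$ and an edge $b$ in direction $120^\circ/300^\circ$; for an up-pointing triangle $a$ is the left and $b$ the right edge; for a down-pointing triangle $a$ is the right and $b$ the left edge. Each edge has a state, a subset of $\{R,G\}$ (red, green), written $\emptyset,R,G,RG$. The allowed tiles, given by the states $(h,a,b)$, are $E=(\emptyset,\emptyset,\emptyset)$, $G_1=(G,G,\emptyset)$, $G_2=(G,RG,R)$, $R_1=(R,\emptyset,R)$, $R_2=(R,G,RG)$, $Q=(RG,G,R)$ (equivariant tile), for both up- and down-pointing triangles, and the $K$-tile $K=(\emptyset,RG,RG)$ for up-pointing triangles only. An equivariant puzzle in a domain is an assignment of an allowed tile to every unit triangle of the domain such that triangles sharing an edge assign it the same state. **Boundary conditions.** Horizontal boundary edges must be in state $R$ or $G$; boundary edges in direction $60^\circ/240^\circ$ in state $G$ or $\emptyset$; boundary edges in direction $120^\circ/300^\circ$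 in state $R$ or $\emptyset$. A side of length $n$, read in a given direction, encodes the Young diagram whose frame is the set of positions (numbered $1,\dots,n$ along the reading direction) of the $G$ edges for horizontal and $60^\circ/240^\circ$ sides, and of the $\emptyset$ edges for $120^\circ/300^\circ$ sides. **Modified weights.** An elementary lozenge is the union of an up-pointing unit triangle and the down-pointing unit triangle just below it, sharing a horizontal edge, both in the domain. Its modified weight depends on a parameter $w$ (depending on its location) and on its (upper tile, lower tile): $(G_2,G_1)$ has weight $w$; $(R_1,R_2)$ has weight $w$; $(Q,Q)$ has weight $1-w$; $(K,E)$ has weight $-1$; all the others, $(G_1,G_1),(G_1,G_2),(G_2,G_2),(R_1,R_1),(R_2,R_1),(R_2,R_2),(E,E)$, have weight $1$. The modified weight of an equivariant puzzle is the product of the modified weights of all its elementary lozenges (unit triangles not belonging to an elementary lozenge contribute no factor). *)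

(* Defs.v *)
From mathcomp Require Import all_boot all_order all_algebra all_fingroup.
From mathcomp Require Import mpoly ring.
From Stdlib Require Import FunctionalExtensionality.

Set Implicit Arguments.
Unset Strict Implicit.
Unset Printing Implicit Defensive.

Import GRing.Theory.
Local Open Scope ring_scope.

(* A Young diagram in the k x (n-k) rectangle is given by its frame, a
   k-subset of {1,...,n}. All indices are shifted to start at 0: the ordinal i
   stands for the i.+1-st step, variable, edge, ... *)
Definition diagram (k n : nat) := {l : {set 'I_n} | #|l| == k}.

Definition frame k n (l : diagram k n) : {set 'I_n} := sval l.

Definition conj_frame n (l : {set 'I_n}) : {set 'I_n} := [set rev_ord i | i in l].

Section Grothendieck.

(* A rational function f in y_1,...,y_n is represented by the function
   y |-> f(y) on n-tuples of a field. These functions are meant to be used at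
   tuples y with pairwise distinct nonzero entries, such as the variables
   themselves, in any order. *)
Variables (F : fieldType) (k n : nat).
Implicit Types (l : {set 'I_n}) (x : 'I_k -> F) (y : 'I_n -> F).

(* D_i, to be used with j = i + 1 *)
Definition divdiff (i j : 'I_n) (f : ('I_n -> F) -> F) y : F :=
  (y i * f y - y j * f (y \o tperm i j)) / (y i - y j).

Definition Gtop x y : F :=
  \prod_(i < k) \prod_(j < n | (j < n - k)%N) (1 - x i / y j).

Definition addable l (ij : 'I_n * 'I_n) : bool :=
  [&& ij.2 == ij.1.+1 :> nat, ij.1 \in l & ij.2 \notin l].

Definition move l (i j : 'I_n) : {set 'I_n} := j |: (l :\ i).

(* Each move of a frame element from i to i + 1 decreases this by one, and no
   move is possible exactly when all the elements are at the far end. *)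
Definition codepth l : nat := \sum_(i in l) (n - i).

Fixpoint Gup_rec (m : nat) l x y : F :=
  if m is m'.+1 then
    if [pick ij | addable l ij] is Some (i, j)
    then divdiff i j (Gup_rec m' (move l i j) x) y
    else Gtop x y
  else Gtop x y.

(* G^l(x; y). The recursion uses one way of reaching l from the full rectangle;
   Gup_top and Gup_step below show that the inductive characterization holds
   for all of them. *)
Definition Gup l x y : F := Gup_rec (codepth l) l x y.

(* G_l(x; y) *)
Definition Gdown l x y : F :=
  (\prod_(i < k) x i) * (\prod_(i in l) (y i)^-1)
  * Gup (conj_frame l) x (y \o @rev_ord n).

Lemma codepth_move l i j :
  addable l (i, j) -> codepth l = (codepth (move l i j)).+1.
Proof.
case/and3P=> /eqP /= ij il jl.
have jn : j \notin l :\ i by rewrite !inE negb_and jl orbT.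
rewrite /codepth /move (big_setD1 i il) /= big_setU1 //= -addSn ij.
by rewrite -subSn ?subSS // -ij.
Qed.

Lemma divdiff_ext i j f g y : f =1 g -> divdiff i j f y = divdiff i j g y.
Proof. by move=> fg; rewrite /divdiff !fg. Qed.

Lemma divdiffC i j i' j' f y :
  i != i' -> i != j' -> j != i' -> j != j' ->
  divdiff i j (divdiff i' j' f) y = divdiff i' j' (divdiff i j f) y.
Proof.
move=> ii ij ji jj; rewrite /divdiff /=.
have -> : (y \o tperm i j) \o tperm i' j' = (y \o tperm i' j') \o tperm i j.
  apply: functional_extensionality => a /=; congr (y _).
  case: (tpermP i' j' a) => [->|->|/eqP a1 /eqP a2].
  - by rewrite (tpermD ii ji) (tpermD ij jj) tpermL.
  - by rewrite (tpermD ii ji) (tpermD ij jj) tpermR.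
  by case: (tpermP i j a) => *; rewrite tpermD // eq_sym.
rewrite !(@tpermD _ i' j') ?(@tpermD _ i j) // 1?eq_sym //.
set A := (y i - y j)^-1; set B := (y i' - y j')^-1; ring.
Qed.

Lemma Gup_top l x y :
  l = [set i : 'I_n | (n - k <= i)%N] -> Gup l x y = Gtop x y.
Proof.
move=> ->; rewrite /Gup; case: (codepth _) => //= m.
case: pickP => // -[i j] /and3P[/eqP /= ij]; rewrite !inE => il.
by rewrite ij (leq_trans il).
Qed.

Lemma move_comm l i j i' j' :
  i != i' -> i != j' -> j != i' ->
  move (move l i' j') i j = move (move l i j) i' j'.
Proof.
move=> ii ij ji; apply/setP=> a; rewrite !inE.
case: (a =P j) => [->|_] /=; first by rewrite ji orbT.
case: (a =P j') => [->|_] /=; first by rewrite eq_sym ij.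
by rewrite andbCA.
Qed.

Lemma Gup_add l i j x y :
  addable l (i, j) -> Gup l x y = divdiff i j (Gup (move l i j) x) y.
Proof.
have [m] := ubnP (codepth l); elim: m => // m IH in l i j y *.
rewrite ltnS => lm a; rewrite {1}/Gup (codepth_move a) /=.
case: pickP => [[i' j'] a'|/(_ (i, j))]; last by rewrite a.
have -> : codepth (move l i j) = codepth (move l i' j').
  by apply: succn_inj; rewrite -!codepth_move.
rewrite -/(Gup _ x).
have [/eqP ij il jl] := and3P a; have [/eqP ij' il' jl'] := and3P a'.
rewrite /= in ij il jl ij' il' jl'.
have [ii|ii] := eqVneq i i'.
  subst i'; suff -> : j' = j by [].
  by apply: val_inj; rewrite /= ij ij'.
have n1 : i != j' by apply: contraNneq jl' => <-.
have n2 : j != i' by apply: contraNneq jl => ->.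
have n3 : j != j'.
  by apply: contra_neq ii => jj; apply/val_inj/succn_inj; rewrite -ij -ij' jj.
have b : addable (move l i' j') (i, j).
  apply/and3P; split=> /=; first by rewrite ij.
  - by rewrite !inE ii il orbT.
  by rewrite !inE (negbTE n3) (negbTE jl) andbF.
have b' : addable (move l i j) (i', j').
  apply/and3P; split=> /=; first by rewrite ij'.
  - by rewrite !inE [i' == i]eq_sym ii il' orbT.
  by rewrite !inE [j' == j]eq_sym (negbTE n3) (negbTE jl') andbF.
rewrite (@divdiff_ext i' j' _ _ y (fun z => IH (move l i' j') i j z _ b)); last first.
  by rewrite -ltnS -(codepth_move a').
rewrite -divdiffC // move_comm //; apply: divdiff_ext => z; apply/esym/IH => //.
by rewrite -(codepth_move a).
Qed.

(* G^m = D_i G^l when the frame of m is obtained from that of l by replacing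
   i + 1 with i. *)
Lemma Gup_step (l m : {set 'I_n}) (i j : 'I_n) x y :
  j = i.+1 :> nat -> j \in l -> i \notin l -> m = i |: (l :\ j) ->
  Gup m x y = divdiff i j (Gup l x) y.
Proof.
move=> ij jl il ->.
have nij : j != i by apply: contraNneq il => <-.
rewrite (@Gup_add _ i j); last first.
  by rewrite /addable /= ij !inE !eqxx /= (negbTE nij).
apply: divdiff_ext => z; congr (Gup _ x z); apply/setP=> a; rewrite !inE.
case: (eqVneq a j) => [->|aj] //=; case: (eqVneq a i) => [->|ai] //=.
by rewrite (negbTE il).
Qed.

End Grothendieck.

Section KTheory.

Variables (k n : nat).

(* The field of rational functions in x_1,...,x_k,y_1,...,y_n. *)
Definition ratfun : fieldType := {fraction {mpoly int[k + n]}}.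

Definition X (i : 'I_k) : ratfun := FracField.tofrac 'X_(lshift n i).
Definition Y (j : 'I_n) : ratfun := FracField.tofrac 'X_(rshift k j).
Definition revY (j : 'I_n) : ratfun := Y (rev_ord j).

(* The value at v of the Laurent polynomial p / 'X_[m]. *)
Definition laurent_eval (N : nat) (p : {mpoly int[N]}) (m : 'X_{1..N})
    (v : 'I_N -> ratfun) : ratfun :=
  mmap intr v p / mmap1 v m.

Definition concat (x : 'I_k -> ratfun) (y : 'I_n -> ratfun)
    (i : 'I_(k + n)) : ratfun :=
  match split i with inl a => x a | inr b => y b end.

(* f is a Laurent polynomial in x_1,...,x_k,y_1,...,y_n with integer
   coefficients and its value at (x, y) is g. When the entries of x and y are
   nonzero, g does not depend on how f is written as p / 'X_[m]. *)
Definition specializes (f : ratfun) (x : 'I_k -> ratfun) (y : 'I_n -> ratfun)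
    (g : ratfun) : Prop :=
  exists p m, f = laurent_eval p m (concat X Y)
           /\ g = laurent_eval p m (concat x y).

Definition laurentY (f : ratfun) : Prop :=
  exists (p : {mpoly int[n]}) (m : 'X_{1..n}), f = laurent_eval p m Y.

Definition KT_ring (f : ratfun) : Prop :=
  forall s : 'S_k, specializes f (X \o s) Y f.

Definition KT_ideal (f : ratfun) : Prop :=
  KT_ring f /\
  forall I : 'I_k -> 'I_n, (forall a b : 'I_k, (a < b)%N -> (I a < I b)%N) ->
    specializes f (Y \o I) Y 0.

(* Equality of classes in the quotient K_T(Gr(k,n)). *)
Definition KT_eq (f g : ratfun) : Prop :=
  [/\ KT_ring f, KT_ring g & KT_ideal (f - g)].

Definition is_structure_coeffs (lam mu : diagram k n)
    (d : diagram k n -> ratfun) : Prop :=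
  (forall nu, laurentY (d nu)) /\
  KT_eq (Gdown (frame lam) X Y * Gdown (frame mu) X revY)
        (\sum_nu d nu * Gdown (frame nu) X revY).

End KTheory.

(* A state records whether red, resp. green, is present. *)
Definition state := (bool * bool)%type.
Definition sO : state := (false, false).
Definition sR : state := (true, false).
Definition sG : state := (false, true).
Definition sRG : state := (true, true).

(* The states (h, a, b) of the edges of a unit triangle. *)
Definition tile := (state * state * state)%type.
Definition edge_h (t : tile) : state := t.1.1.
Definition edge_a (t : tile) : state := t.1.2.
Definition edge_b (t : tile) : state := t.2.

Definition tE : tile := (sO, sO, sO).
Definition tG1 : tile := (sG, sG, sO).
Definition tG2 : tile := (sG, sRG, sR).
Definition tR1 : tile := (sR, sO, sR).
Definition tR2 : tile := (sR, sG, sRG).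
Definition tQ : tile := (sRG, sG, sR).
Definition tK : tile := (sO, sRG, sRG).

Definition down_tiles : seq tile := [:: tE; tG1; tG2; tR1; tR2; tQ].
Definition up_tiles : seq tile := tK :: down_tiles.

Section Puzzles.

Variable n : nat.

(* In the down-pointing triangle of side n, (r, c) is the c-th down-pointing
   unit triangle from the left in the r-th row from the top, or the up-pointing
   unit triangle between the down-pointing ones (r, c) and (r, c+1). *)
Definition down_pos := {p : 'I_n * 'I_n | (p.1 + p.2 < n)%N}.
Definition up_pos := {p : 'I_n * 'I_n | (p.1 + p.2.+1 < n)%N}.

Definition drow (v : down_pos) : 'I_n := (sval v).1.
Definition dcol (v : down_pos) : 'I_n := (sval v).2.
Definition urow (u : up_pos) : 'I_n := (sval u).1.
Definition ucol (u : up_pos) : 'I_n := (sval u).2.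

Definition tiling := ({ffun down_pos -> tile} * {ffun up_pos -> tile})%type.

(* The up-pointing triangle (r, c) has the down-pointing triangles (r, c),
   (r, c+1) and (r+1, c) on its left, on its right and below it. *)
Definition at_left (u : up_pos) (v : down_pos) : bool :=
  (drow v == urow u :> nat) && (dcol v == ucol u :> nat).
Definition at_right (u : up_pos) (v : down_pos) : bool :=
  (drow v == urow u :> nat) && (dcol v == (ucol u).+1 :> nat).
Definition below (u : up_pos) (v : down_pos) : bool :=
  (drow v == (urow u).+1 :> nat) && (dcol v == ucol u :> nat).

Definition is_puzzle (P : tiling) : bool :=
  [&& [forall v, P.1 v \in down_tiles],
      [forall u, P.2 u \in up_tiles] &
      [forall u, forall v,
        [&& at_left u v ==> (edge_a (P.2 u) == edge_a (P.1 v)),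
            at_right u v ==> (edge_b (P.2 u) == edge_b (P.1 v)) &
            below u v ==> (edge_h (P.2 u) == edge_h (P.1 v))]]].

(* lam is read downwards on the left side, mu from right to left on the top
   side, nu downwards on the right side. *)
Definition has_boundary (lam mu nu : {set 'I_n}) (P : tiling) : bool :=
  [forall v : down_pos,
    [&& (dcol v == 0 :> nat) ==>
          (edge_b (P.1 v) == if drow v \in lam then sO else sR),
        (drow v == 0 :> nat) ==>
          (edge_h (P.1 v) == if rev_ord (dcol v) \in mu then sG else sR) &
        (drow v + (dcol v).+1 == n)%N ==>
          (edge_a (P.1 v) == if drow v \in nu then sG else sO)]].

Definition lozenge_weight (F : fieldType) (w : F) (upper lower : tile) : F :=
  if (upper, lower) == (tG2, tG1) then w
  else if (upper, lower) == (tR1, tR2) then w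
  else if (upper, lower) == (tQ, tQ) then 1 - w
  else if (upper, lower) == (tK, tE) then -1
  else 1.

(* The centre of the lozenge formed by the up-pointing triangle (r, c) and the
   down-pointing triangle (r+1, c) is on the horizontal line r+1 levels below
   the top side; going up-left by one level keeps the column, going up-right
   increases it by one. So i = c and j = c + r + 1 when numbering from 0. *)
Definition lozenge_param (F : fieldType) (y : 'I_n -> F) (u : up_pos) : F :=
  y (ucol u) / y (Ordinal (svalP u)).

Definition puzzle_weight (F : fieldType) (y : 'I_n -> F) (P : tiling) : F :=
  \prod_u \prod_(v | below u v)
    lozenge_weight (lozenge_param y u) (P.2 u) (P.1 v).

Definition puzzle_sum (F : fieldType) (y : 'I_n -> F) (lam mu nu : {set 'I_n}) : F :=
  \sum_(P : tiling | is_puzzle P && has_boundary lam mu nu P) puzzle_weight y P.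

End Puzzles.

(* Main.v *)
Require Import Defs.
From mathcomp Require Import all_boot all_order all_algebra all_fingroup.
From mathcomp Require Import mpoly ring zify.
From Stdlib Require Import FunctionalExtensionality.

Set Implicit Arguments.
Unset Strict Implicit.
Unset Printing Implicit Defensive.

Import GRing.Theory.
Local Open Scope ring_scope.

(* Both sides of the product formula are compared at the fixed points x = y_I.
   A puzzle is cut into strips, one for each variable y_i, and the sum of the
   weights becomes a product of strip operators acting on boundary words, whose
   letters are indexed by the variables. Exchanging y_i and y_(i+1) in this
   product amounts to applying R-matrices to the three sides (Yang-Baxter
   equations for the lozenges, plus one relation for a triangle of side 2).
   The divided difference recursion says that the vectors of polynomials G_l and
   G^l are transformed by the same R-matrices, so the product formula at x for
   y is equivalent to the one for y with y_i and y_(i+1) exchanged. This reduces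
   the formula to x = (y_1, ..., y_k), where all but one term vanish and the
   first strip can be peeled off, by induction on k. Conversely, the matrix of
   the G_nu(y_I; revY) is shown to be invertible by induction on n, which gives
   the uniqueness of the coefficients. *)

(** The operators are written in continuation form: each takes the incoming edges of a region and a
    function of its outgoing edges. Sums over inner edges then never appear, operators compose by
    nesting, and the Yang-Baxter equations become finite checks over edge states. An exchange of
    variables mixes the value at a word with the value at the word with two letters swapped, so the
    formula for one pair of diagrams is not stable and has to be stated for all left and top words
    at once. The point x stays fixed while the variables move: an exchange lowers one index of I,
    until I is an initial segment. Inner edges may carry states that never occur on the boundary.
    The vectors of polynomials are therefore extended by zero to all words. The R-matrices respect
    this because they only permute letters, and conservation of green excludes the remaining bad
    words. The polynomials are defined through divisions by y_i - y_(i+1), as functions on tuples,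
    whereas the quotient ring speaks of Laurent polynomials; they must be recognized as such before
    their values at y_I say anything about classes. *)

Local Notation O := (false, false) (only parsing).
Local Notation R := (true, false) (only parsing).
Local Notation G := (false, true) (only parsing).
Local Notation RG := (true, true) (only parsing).

(** * Strip operators and Yang-Baxter equations *)

Lemma split2 (T U : Type) (w : seq T) (ps qs : seq U) y1 y2 :
  size w = size (ps ++ y1 :: y2 :: qs) ->
  exists p a b q,
    [/\ w = p ++ a :: b :: q, size p = size ps & size q = size qs].
Proof.
elim: ps w => [|y ps IH] [|a w] //=.
  by case: w => // b q [sq]; exists [::], a, b, q.
by case=> /IH[p [b [c [q [-> sp sq]]]]]; exists (a :: p), b, c, q;
  rewrite /= sp.
Qed.

Section StripOperators.

Variable F : fieldType.
Implicit Types (y w r : F) (ys : seq F) (a l h : state) (la hs : seq state).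

(* The sum over the tilings of an elementary lozenge of parameter w with upper
   left edge a and lower left edge l of X applied to its right edges. *)
Definition loz w (X : state -> state -> F) a l : F :=
  match a, l with
  | O, O => X O O
  | O, R => X R O
  | O, RG => w * X R G
  | G, O => X O G
  | G, R => X O RG + X RG O + (1 - w) * X R G
  | G, RG => X RG G
  | RG, O => w * X R G - X RG O
  | RG, R => X R RG
  | _, _ => 0
  end.

(** The down-pointing tile at the top of a strip: its horizontal edge [h] and left edge [l]
    determine its right edge, at which [f] is evaluated. The value is 0 when no tile fits. *)
Definition corner h l (f : state -> F) : F :=
  match h, l with
  | O, O => f O
  | G, O => f G
  | G, R => f RG
  | R, R => f O
  | R, RG => f G
  | RG, R => f G
  | _, _ => 0
  end.

(* The column of lozenges on the line y1, entered from above through the edge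
   a; la is the word on its left side and Phi is applied to the word on its
   right side and to the last edge. *)
Fixpoint strip y1 ys (Phi : seq state -> state -> F) a la : F :=
  match ys, la with
  | [::], [::] => Phi [::] a
  | y :: ys', l :: la' =>
      loz (y1 / y) (fun k a' => strip y1 ys' (fun ka => Phi (k :: ka)) a' la')
          a l
  | _, _ => 0
  end.

(* The right side of a puzzle is read upwards here, so that the i-th letters
   of its three sides all belong to the line y_i. *)
Fixpoint puz ys hs (Xi : seq state -> F) la : F :=
  match ys, hs, la with
  | [::], [::], [::] => Xi [::]
  | y :: ys', h :: hs', l :: la' =>
      corner h l (fun a =>
        strip y ys' (fun ka v => puz ys' hs' (fun vs => Xi (v :: vs)) ka) a la')
  | _, _, _ => 0
  end.

(* The R-matrices of the left, right and top sides, found by solving the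
   Yang-Baxter equations loz_Rleft and loz_Rright and the corner equation
   corner_Rtop. *)
Definition Rleft w (X : state -> state -> F) a b : F :=
  match a, b with
  | O, R => X O R + (1 - w) * X R O
  | O, RG => w * X O RG + (1 - w) * X RG O
  | R, O => w * X R O
  | R, RG => w * X R RG
  | RG, R => X RG R + (1 - w) * X R RG
  | _, _ => X a b
  end.

Definition Rright r (X : state -> state -> F) a b : F :=
  match a, b with
  | O, G => X O G + (1 - r) * X G O
  | O, RG => X O RG + (1 - r) * X RG O
  | G, O => r * X G O
  | G, RG => r * X G RG
  | RG, O => r * X RG O
  | RG, G => X RG G + (1 - r) * X G RG
  | _, _ => X a b
  end.

Definition Rtop r (X : state -> state -> F) a b : F :=
  match a, b with
  | R, G => X R G + (1 - r) * X G R
  | G, R => r * X G R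
  | _, _ => X a b
  end.

Lemma loz_lin w c1 c2 (X1 X2 : state -> state -> F) a l :
  loz w (fun k a' => c1 * X1 k a' + c2 * X2 k a') a l
  = c1 * loz w X1 a l + c2 * loz w X2 a l.
Proof. by case: a l => [[] []] [[] []] /=; ring. Qed.

Lemma corner_lin c1 c2 (f1 f2 : state -> F) h l :
  corner h l (fun a => c1 * f1 a + c2 * f2 a)
  = c1 * corner h l f1 + c2 * corner h l f2.
Proof. by case: h l => [[] []] [[] []] /=; ring. Qed.

Lemma eq_loz w (X1 X2 : state -> state -> F) a l :
  X1 =2 X2 -> loz w X1 a l = loz w X2 a l.
Proof. by move=> E; case: a l => [[] []] [[] []] //=; rewrite !E. Qed.

Lemma eq_corner (f1 f2 : state -> F) h l :
  f1 =1 f2 -> corner h l f1 = corner h l f2.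
Proof. by move=> E; case: h l => [[] []] [[] []] //=; rewrite !E. Qed.

Lemma eq_Rleft w (X1 X2 : state -> state -> F) a b :
  X1 =2 X2 -> Rleft w X1 a b = Rleft w X2 a b.
Proof. by move=> E; case: a b => [[] []] [[] []] //=; rewrite !E. Qed.

Lemma eq_Rright w (X1 X2 : state -> state -> F) a b :
  X1 =2 X2 -> Rright w X1 a b = Rright w X2 a b.
Proof. by move=> E; case: a b => [[] []] [[] []] //=; rewrite !E. Qed.

Lemma eq_Rtop w (X1 X2 : state -> state -> F) a b :
  X1 =2 X2 -> Rtop w X1 a b = Rtop w X2 a b.
Proof. by move=> E; case: a b => [[] []] [[] []] //=; rewrite !E. Qed.

(** An R-matrix only combines [X a b] and [X b a], with coefficients that do not depend on [X]. In
    this form it commutes with every operator known to be linear, without another case analysis on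
    states. *)
Lemma Rleft_lin w a b :
  exists c1 c2, forall X, Rleft w X a b = c1 * X a b + c2 * X b a.
Proof.
case: a b => [[] []] [[] []];
  first [exists 1, 0 => X /=; ring | exists w, 0 => X /=; ring
        | exists 1, (1 - w) => X /=; ring | exists w, (1 - w) => X /=; ring].
Qed.

Lemma Rright_lin w a b :
  exists c1 c2, forall X, Rright w X a b = c1 * X a b + c2 * X b a.
Proof.
case: a b => [[] []] [[] []];
  first [exists 1, 0 => X /=; ring | exists w, 0 => X /=; ring
        | exists 1, (1 - w) => X /=; ring].
Qed.

Lemma Rtop_lin w a b :
  exists c1 c2, forall X, Rtop w X a b = c1 * X a b + c2 * X b a.
Proof.
case: a b => [[] []] [[] []];
  first [exists 1, 0 => X /=; ring | exists w, 0 => X /=; ring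
        | exists 1, (1 - w) => X /=; ring].
Qed.

Lemma strip_lin y1 ys c1 c2 (P1 P2 : seq state -> state -> F) a la :
  strip y1 ys (fun ka v => c1 * P1 ka v + c2 * P2 ka v) a la
  = c1 * strip y1 ys P1 a la + c2 * strip y1 ys P2 a la.
Proof.
elim: ys P1 P2 a la => [|y ys IH] P1 P2 a [|l la] //=; try by ring.
by rewrite -loz_lin; apply: eq_loz => k a'; rewrite -IH.
Qed.

Section Conserved.

(* Flow conservation of a colour through the tiles. *)
Variable c : state -> bool.
Hypothesis c_color : c = fst \/ c = snd.

Definition flow la : nat := sumn [seq (c s : nat) | s <- la].

Lemma flow_cons a la : flow (a :: la) = (c a + flow la)%N.
Proof. by []. Qed.

(** Extensionality over only those outcomes that conserve the colour; this is how words excluded by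
    the colours of the boundary are discarded later. *)
Lemma eq_loz_flow w (X1 X2 : state -> state -> F) a l :
  (forall k a', (c k + c a' = c a + c l)%N -> X1 k a' = X2 k a') ->
  loz w X1 a l = loz w X2 a l.
Proof.
by move=> E; case: c_color E => -> E; case: a l E => [[] []] [[] []] E //=;
  rewrite ?E.
Qed.

Lemma eq_strip_flow y1 ys (P1 P2 : seq state -> state -> F) a la :
  (forall ka v, size ka = size ys -> (flow ka + c v = c a + flow la)%N ->
     P1 ka v = P2 ka v) ->
  strip y1 ys P1 a la = strip y1 ys P2 a la.
Proof.
elim: ys P1 P2 a la => [|y ys IH] P1 P2 a [|l la] E //=.
  by apply: E => //; rewrite /flow /= addn0 add0n.
apply: eq_loz_flow => k a' ka'; apply: IH => ka v s e; apply: E => /=.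
  by rewrite s.
by rewrite !flow_cons -addnA e addnA ka' addnA.
Qed.

End Conserved.

Lemma eq_strip y1 ys (P1 P2 : seq state -> state -> F) a la :
  (forall ka v, size ka = size ys -> P1 ka v = P2 ka v) ->
  strip y1 ys P1 a la = strip y1 ys P2 a la.
Proof. by move=> E; apply: (eq_strip_flow (or_introl erefl)) => *;
  apply: E. Qed.

(** Green entering through [h] and [l] leaves through the right edge. Red has another balance, a.1 +
    h.1 = l.1, so green is the colour followed through a whole puzzle. *)
Lemma eq_corner_green (f1 f2 : state -> F) h l :
  (forall a, (a.2 = h.2 + l.2 :> nat)%N -> f1 a = f2 a) ->
  corner h l f1 = corner h l f2.
Proof. by case: h l => [[] []] [[] []] E //=; rewrite ?E. Qed.

Lemma eq_puz_green ys hs (X1 X2 : seq state -> F) la :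
  (forall v, size v = size ys -> flow snd v = (flow snd hs + flow snd la)%N ->
     X1 v = X2 v) ->
  puz ys hs X1 la = puz ys hs X2 la.
Proof.
elim: ys hs X1 X2 la => [|y ys IH] [|h hs] X1 X2 [|l la] E //=.
  exact: E.
apply: eq_corner_green => a ea.
apply: (eq_strip_flow (or_intror erefl)) => ka v s e.
apply: IH => vs sv ev; apply: E => /=; first by rewrite sv.
rewrite !flow_cons ev addnCA [(v.2 + _)%N]addnC e ea.
by rewrite addnA addnCA addnA addnA.
Qed.

Lemma strip0 y1 ys a la : strip y1 ys (fun _ _ => 0) a la = 0.
Proof.
elim: ys a la => [|y ys IH] a [|l la] //=.
by case: a l => [[] []] [[] []] //=; rewrite ?IH; ring.
Qed.

Lemma stripZ y1 ys c (P : seq state -> state -> F) a la :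
  strip y1 ys (fun ka v => c * P ka v) a la = c * strip y1 ys P a la.
Proof.
have := @strip_lin y1 ys c 0 P P a la.
rewrite mul0r addr0 => <-; apply: eq_strip => *; by rewrite mul0r addr0.
Qed.

Lemma stripD y1 ys (P1 P2 : seq state -> state -> F) a la :
  strip y1 ys (fun ka v => P1 ka v + P2 ka v) a la
  = strip y1 ys P1 a la + strip y1 ys P2 a la.
Proof.
have := @strip_lin y1 ys 1 1 P1 P2 a la.
rewrite !mul1r => <-; apply: eq_strip => *; by rewrite !mul1r.
Qed.

Lemma stripN y1 ys (P : seq state -> state -> F) a la :
  strip y1 ys (fun ka v => - P ka v) a la = - strip y1 ys P a la.
Proof.
by rewrite -mulN1r -stripZ; apply: eq_strip => *; rewrite mulN1r.
Qed.

Lemma strip_loz y1 ys w (Y : state -> state -> seq state -> state -> F)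
    a b l la :
  strip y1 ys (fun ka v => loz w (fun k a' => Y k a' ka v) b l) a la
  = loz w (fun k a' => strip y1 ys (Y k a') a la) b l.
Proof.
by case: b l => [[] []] [[] []] /=;
  rewrite ?stripD ?stripN ?stripZ ?strip0.
Qed.

Lemma strip_corner y1 ys (f : state -> seq state -> state -> F) h l a la :
  strip y1 ys (fun ka v => corner h l (fun b => f b ka v)) a la
  = corner h l (fun b => strip y1 ys (f b) a la).
Proof. by case: h l => [[] []] [[] []] /=; rewrite ?strip0. Qed.

Lemma strip_Rleft y1 ys w (Y : state -> state -> seq state -> state -> F)
    a k1 k2 la :
  strip y1 ys (fun ka v => Rleft w (fun k k' => Y k k' ka v) k1 k2) a la
  = Rleft w (fun k k' => strip y1 ys (Y k k') a la) k1 k2.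
Proof.
have [c1 [c2 E]] := Rleft_lin w k1 k2; rewrite E -strip_lin.
by apply: eq_strip => ka v _; rewrite E.
Qed.

Lemma strip_Rtop y1 ys w (Y : state -> state -> seq state -> state -> F)
    a k1 k2 la :
  strip y1 ys (fun ka v => Rtop w (fun k k' => Y k k' ka v) k1 k2) a la
  = Rtop w (fun k k' => strip y1 ys (Y k k') a la) k1 k2.
Proof.
have [c1 [c2 E]] := Rtop_lin w k1 k2; rewrite E -strip_lin.
by apply: eq_strip => ka v _; rewrite E.
Qed.

(** Yang-Baxter equation for the strip y1 crossing the two lines y2 and y3: the R-matrix passes from
    the word on the right of the strip to the word on its left. *)
Lemma loz_Rleft y1 y2 y3 (Y : state -> state -> state -> F) a l1 l2 :
  y2 != 0 -> y3 != 0 ->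
  loz (y1 / y3) (fun k1 a' => loz (y1 / y2) (fun k2 a'' =>
    Rleft (y3 / y2) (fun k1 k2 => Y k1 k2 a'') k1 k2) a' l2) a l1
  = Rleft (y3 / y2) (fun l1 l2 =>
      loz (y1 / y2) (fun k1 a' => loz (y1 / y3) (fun k2 a'' =>
        Y k1 k2 a'') a' l2) a l1) l1 l2.
Proof.
by move=> y20 y30; case: a l1 l2 => [[] []] [[] []] [[] []] //=; field;
  rewrite ?y20 ?y30.
Qed.

(** Yang-Baxter equation for two adjacent strips y1 and y2 crossing one line y: the R-matrix moves
    from the lower ends of the strips to the upper ends. *)
Lemma loz_Rright y1 y2 y (Y : state -> state -> state -> F) a b l :
  y != 0 -> y2 != 0 ->
  loz (y2 / y) (fun m a' => loz (y1 / y) (fun k b' =>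
    Rright (y1 / y2) (Y k) a' b') b m) a l
  = Rright (y1 / y2) (fun a b =>
      loz (y1 / y) (fun m a' => loz (y2 / y) (fun k b' => Y k a' b') b m) a l)
      a b.
Proof.
by move=> y0 y20; case: a b l => [[] []] [[] []] [[] []] //=; field;
  rewrite ?y0 ?y20.
Qed.

Definition top_state h := (h == R) || (h == G).

(** The triangle of side 2 in which two neighbouring strips start. Here the R-matrix coming up along
    the strips is traded for those of the top and the left side. *)
Lemma corner_Rtop y1 y2 (Y : state -> state -> F) h1 h2 l1 l2 :
  y1 != 0 -> y2 != 0 -> top_state h1 -> top_state h2 ->
  corner h1 l1 (fun a => loz (y2 / y1) (fun k a' =>
     corner h2 k (fun b => Rright (y1 / y2) Y a' b)) a l2)
  = Rtop (y1 / y2) (fun h1 h2 => Rleft (y2 / y1) (fun l1 l2 =>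
      corner h1 l1 (fun a => loz (y1 / y2) (fun k a' =>
        corner h2 k (Y a')) a l2)) l1 l2) h1 h2.
Proof.
by move=> y10 y20; case: h1 h2 l1 l2 => [[] []] [[] []] [[] []] [[] []] // _ _
  //=;
  field; rewrite ?y10 ?y20.
Qed.

(** [Phi'] is constrained by a relation, at every prefix of the right length, instead of being given
    by a formula: the prefix of the output word grows as the induction goes down the strip to the
    two exchanged lines. *)
Lemma strip_cat_Rleft y1 y2 y3 ps qs (Phi Phi' : seq state -> state -> F)
    a pl ql l1 l2 :
  y2 != 0 -> y3 != 0 -> size pl = size ps ->
  (forall p q k1 k2 v, size p = size ps ->
     Phi' (p ++ k1 :: k2 :: q) v
     = Rleft (y3 / y2) (fun k1 k2 => Phi (p ++ k1 :: k2 :: q) v) k1 k2) ->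
  strip y1 (ps ++ y3 :: y2 :: qs) Phi' a (pl ++ l1 :: l2 :: ql)
  = Rleft (y3 / y2) (fun l1 l2 =>
     strip y1 (ps ++ y2 :: y3 :: qs) Phi a (pl ++ l1 :: l2 :: ql)) l1 l2.
Proof.
move=> y20 y30.
elim: ps pl Phi Phi' a => [|y ps IH] [|l pl] // Phi Phi' a => [_|[s]] E /=.
  rewrite -loz_Rleft //; apply: eq_loz => k1 a'; apply: eq_loz => k2 a''.
  by rewrite -strip_Rleft; apply: eq_strip => ka v _; rewrite -(E [::]).
have comm w w' (Y : state -> state -> state -> state -> F) :
  loz w (fun k a' => Rleft w' (fun l1 l2 => Y k a' l1 l2) l1 l2) a l =
  Rleft w' (fun l1 l2 => loz w (fun k a' => Y k a' l1 l2) a l) l1 l2.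
  have [c1 [c2 E']] := Rleft_lin w' l1 l2; rewrite E' -loz_lin.
  by apply: eq_loz => k a' /=; rewrite E'.
rewrite -comm; apply: eq_loz => k a'.
by apply: IH => // p q k1 k2 v sp; rewrite -(E (k :: p)) //= sp.
Qed.

Lemma strip2_Rright y1 y2 ys (Phi Phi' : seq state -> state -> state -> F)
    a b la :
  y2 != 0 -> all (predC1 0) ys ->
  (forall ka v1 v2, Phi' ka v1 v2 = Rright (y1 / y2) (Phi ka) v1 v2) ->
  strip y2 ys (fun ka v1 => strip y1 ys (fun ka' => Phi' ka' v1) b ka) a la
  = Rright (y1 / y2) (fun a b =>
      strip y1 ys (fun ka v1 => strip y2 ys (fun ka' => Phi ka' v1) b ka) a la)
      a b.
Proof.
move=> y20.
elim: ys Phi Phi' a b la => [|y ys IH] Phi Phi' a b [|l la] ys0 E /=.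
- exact: E.
- by case: a b => [[] []] [[] []] /=; ring.
- by case: a b => [[] []] [[] []] /=; ring.
case/andP: ys0 => /= y0 ys0.
under eq_loz => m a' do rewrite strip_loz.
under eq_Rright => a1 b1.
  under eq_loz => m a' do rewrite strip_loz.
  over.
rewrite -loz_Rright //; apply: eq_loz => m a'; apply: eq_loz => k b'.
by apply: IH => // ka v1 v2; rewrite E.
Qed.

Lemma puz_lin ys hs c1 c2 (X1 X2 : seq state -> F) la :
  puz ys hs (fun vs => c1 * X1 vs + c2 * X2 vs) la
  = c1 * puz ys hs X1 la + c2 * puz ys hs X2 la.
Proof.
elim: ys hs X1 X2 la => [|y ys IH] [|h hs] X1 X2 [|l la] //=; try by ring.
rewrite -corner_lin; apply: eq_corner => a; rewrite -strip_lin.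
by apply: eq_strip => ka v _; rewrite -IH.
Qed.

Lemma puz_Rright w ys hs (X : state -> state -> seq state -> F) a b la :
  puz ys hs (fun vs => Rright w (fun a b => X a b vs) a b) la
  = Rright w (fun a b => puz ys hs (X a b) la) a b.
Proof.
have [c1 [c2 E]] := Rright_lin w a b; rewrite E -puz_lin.
by apply: eq_puz_green => vs _ _; rewrite E.
Qed.

(** The R-matrix hidden in [Xi'] acts on the ends of the two exchanged strips. It moves up along
    them by [strip2_Rright] and splits by [corner_Rtop] into [Rtop] and [Rleft]; the latter crosses
    the preceding strips one at a time until it reaches the left side. *)
Lemma puz_exchange y1 y2 ps qs ph qh pl ql h1 h2 l1 l2
    (Xi Xi' : seq state -> F) :
  all (predC1 0) (ps ++ y1 :: y2 :: qs) ->
  size ph = size ps -> size pl = size ps -> top_state h1 -> top_state h2 ->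
  (forall p q a b, size p = size ps ->
     Xi' (p ++ a :: b :: q)
     = Rright (y1 / y2) (fun a b => Xi (p ++ a :: b :: q)) a b) ->
  puz (ps ++ y2 :: y1 :: qs) (ph ++ h1 :: h2 :: qh) Xi' (pl ++ l1 :: l2 :: ql)
  = Rtop (y1 / y2) (fun h1 h2 => Rleft (y2 / y1) (fun l1 l2 =>
      puz (ps ++ y1 :: y2 :: qs) (ph ++ h1 :: h2 :: qh) Xi
          (pl ++ l1 :: l2 :: ql)) l1 l2) h1 h2.
Proof.
elim: ps ph pl Xi Xi' l1 l2 ql
  => [|y ps IH] [|h ph] [|l pl] // Xi Xi' l1 l2 ql.
  move=> /and3P[/= y10 y20 qs0] _ _ t1 t2 E /=.
  under [in RHS]eq_Rtop => h1' h2'.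
    under eq_Rleft => l1' l2'.
      under eq_corner => a.
        under eq_loz => k a' do rewrite strip_corner.
        over.
      over.
    over.
  rewrite -corner_Rtop //; apply: eq_corner => a; apply: eq_loz => k a'.
  rewrite strip_corner; apply: eq_corner => b.
  rewrite -(strip2_Rright (Phi' := fun ka v1 v2 =>
    puz qs qh (fun vs => Xi' [:: v1, v2 & vs]) ka)) // => ka v1 v2.
  rewrite -puz_Rright; congr (puz _ _ _ _).
  by apply: functional_extensionality => vs; rewrite (E [::]).
move=> /= /andP[y0 ne0] [sh] [sl] t1 t2 E.
have comm h' l' (Z : state -> state -> state -> state -> state -> F) :
  corner h' l' (fun a => Rtop (y1 / y2) (fun h1 h2 => Rleft (y2 / y1)
     (fun l1 l2 => Z a h1 h2 l1 l2) l1 l2) h1 h2)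
  = Rtop (y1 / y2) (fun h1 h2 => Rleft (y2 / y1) (fun l1 l2 =>
     corner h' l' (fun a => Z a h1 h2 l1 l2)) l1 l2) h1 h2.
  have [c1 [c2 El]] := Rleft_lin (y2 / y1) l1 l2.
  have [d1 [d2 Et]] := Rtop_lin (y1 / y2) h1 h2.
  rewrite Et !El -!corner_lin; by apply: eq_corner => b /=; rewrite Et !El.
rewrite -comm; apply: eq_corner => a.
have y10 : y1 != 0.
  by move: ne0; rewrite all_cat => /andP[_ /and3P[]].
have y20 : y2 != 0.
  by move: ne0; rewrite all_cat => /andP[_ /and3P[]].
under [in RHS]eq_Rtop => h1' h2'.
  (* The output function must be defined on an arbitrary word [ka], so the two letters to be
     exchanged are extracted by position. The words concerned are long enough for the default [O]
     not to occur. *)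
  rewrite -(@strip_cat_Rleft _ _ _ _ _ _ (fun ka v => Rleft (y2 / y1) (fun k1
    k2 =>
    puz (ps ++ y1 :: y2 :: qs) (ph ++ h1' :: h2' :: qh)
       (fun vs => Xi (v :: vs)) (take (size ps) ka ++ k1 :: k2 :: drop (size
         ps).+2 ka))
     (nth O ka (size ps)) (nth O ka (size ps).+1))) //; last first.
    move=> p q k1 k2 v sp; rewrite -sp take_size_cat // nth_cat ltnn subnn /=.
    rewrite nth_cat ltnNge leqnSn /= subSn // subnn /= drop_cat.
    rewrite ltnNge (leq_trans (leqnSn _) (leqnSn _)) /= -addn2 addKn /= drop0.
    by apply: eq_Rleft.
  over.
rewrite -strip_Rtop; apply: eq_strip => ka v ska.
have [p [k1 [k2 [q [-> sp _]]]]] := split2 ska.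
rewrite (IH ph p (fun vs => Xi (v :: vs)) (fun vs => Xi' (v :: vs)) k1 k2 q ne0
  sh sp t1 t2); last first.
  by move=> p' q' a' b' sp'; rewrite -(E (v :: p')) //= sp'.
apply: eq_Rtop => h1' h2'.
rewrite -sp take_size_cat // nth_cat ltnn subnn /=.
rewrite nth_cat ltnNge leqnSn /= subSn // subnn /= drop_cat.
by rewrite ltnNge (leq_trans (leqnSn _) (leqnSn _)) /= -addn2 addKn /= drop0.
Qed.

End StripOperators.

(** * Double Grothendieck polynomials *)

Section GrothendieckPolynomials.

Variable F : fieldType.

Section Exchange.

Variables k n : nat.
Implicit Types (l : {set 'I_n}) (x : 'I_k -> F) (y : 'I_n -> F).

Lemma Gup_noadd l x y : (forall ij, ~~ addable l ij) -> Gup l x y = Gtop x y.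
Proof.
move=> na; rewrite /Gup; case: (codepth l) => //= m.
by case: pickP => // ij; rewrite (negbTE (na ij)).
Qed.

(** The hypothesis covers all frames of smaller codepth, not only the moved one, because the
    symmetry proof needs two successive moves. *)
Lemma addable_ind (P : {set 'I_n} -> Prop) :
  (forall l, (forall ij, ~~ addable l ij) -> P l) ->
  (forall l i j, addable l (i, j) ->
     (forall l', (codepth l' < codepth l)%N -> P l') -> P l) ->
  forall l, P l.
Proof.
move=> P0 PS l; have [m] := ubnP (codepth l); elim: m => // m IH in l *.
rewrite ltnS => lm; case: (pickP (addable l)) => [[i j] a|na].
  by apply: PS a _ => l' l'l; apply: IH; apply: leq_trans lm.
by apply: P0 => ij; rewrite na.
Qed.

Lemma inj_tperm y (i j : 'I_n) : injective y -> injective (y \o tperm i j).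
Proof. by move=> yi; apply: inj_comp => //; apply: perm_inj. Qed.

Lemma tperm_comp2 y (i j : 'I_n) : (y \o tperm i j) \o tperm i j = y.
Proof.
by apply: functional_extensionality => a /=; rewrite tpermK.
Qed.

Lemma tperm_compC y (i j a b : 'I_n) : a != i -> a != j -> b != i -> b != j ->
  (y \o tperm i j) \o tperm a b = (y \o tperm a b) \o tperm i j.
Proof.
move=> ai aj bi bj; apply: functional_extensionality => c /=; congr (y _).
case: (tpermP a b c) => [->|->|/eqP ca /eqP cb].
- by rewrite (tpermD (z := b)) 1?eq_sym // (tpermD (z := a)) 1?eq_sym // tpermL.
- by rewrite (tpermD (z := a)) 1?eq_sym // (tpermD (z := b)) 1?eq_sym // tpermR.
by case: (tpermP i j c) => *; rewrite tpermD // eq_sym.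
Qed.

Lemma tperm_braid y (p q r : 'I_n) : p != q -> p != r -> q != r ->
  ((y \o tperm p q) \o tperm q r) \o tperm p q
  = ((y \o tperm q r) \o tperm p q) \o tperm q r.
Proof.
move=> pq pr qr; apply: functional_extensionality => c /=; congr (y _).
rewrite -!permM; congr (fun_of_perm _ c).
have E : (tperm p q ^ tperm q r = tperm q r ^ tperm p q)%g.
  rewrite !tpermJ tpermL tpermR (@tpermD _ q r p) 1?eq_sym //.
  by rewrite (@tpermD _ p q r).
move: E; rewrite !conjgE !tpermV => E.
by rewrite ?mulgA in E *; rewrite E.
Qed.

(** Without a possible move the frame is closed under successors, hence a final segment, and its
    cardinality says which one. *)
Lemma noadd_top l : (forall ij, ~~ addable l ij) ->
  l = [set i : 'I_n | (n - #|l| <= i)%N].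
Proof.
move=> na.
have up m (i j : 'I_n) : i \in l -> j = (i + m)%N :> nat -> j \in l.
  elim: m j => [|m IH] j il e; first by rewrite (val_inj (_ : j = i :> nat)) //
    e addn0.
  have lt : (i + m < n)%N by rewrite (leq_trans _ (ltn_ord j)) // e addnS.
  have := na (Ordinal lt, j); rewrite /addable /= e addnS eqxx /=.
  by rewrite (IH (Ordinal lt)) //= negbK.
have cardt : #|[set i : 'I_n | (n - #|l| <= i)%N]| = #|l|.
  have le := max_card l; rewrite card_ord in le.
  have -> : [set i : 'I_n | (n - #|l| <= i)%N] = ~: [set i : 'I_n | (i < n -
    #|l|)%N].
    by apply/setP=> i; rewrite !inE -leqNgt.
  rewrite cardsCs setCK card_ord.
  have -> : #|[set i : 'I_n | (i < n - #|l|)%N]| = (n - #|l|)%N;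
    last by rewrite subKn.
  rewrite -sum1_card (eq_bigl (fun i : 'I_n => (i < n - #|l|)%N));
    last by move=> i; rewrite inE.
  by rewrite (big_ord_narrow (leq_subr _ _)) sum1_card card_ord.
have [lt|/subsetPn[a al]] := boolP (l \subset [set i : 'I_n | (n - #|l| <=
  i)%N]).
  by apply/eqP; rewrite eqEcard lt cardt /=.
rewrite inE -ltnNge => at'.
apply/esym/eqP; rewrite eqEcard cardt leqnn andbT; apply/subsetP=> b;
  rewrite inE => bt.
apply: (up (b - a)%N a) => //; rewrite subnKC //.
exact: ltnW (leq_trans at' bt).
Qed.

Lemma divdiff_sym (i j : 'I_n) (f : ('I_n -> F) -> F) y : injective y -> i != j
  ->
  divdiff i j f (y \o tperm i j) = divdiff i j f y.
Proof.
move=> yi ij; rewrite /divdiff /= tpermL tpermR tperm_comp2.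
by rewrite -(opprB (y i)) invrN mulrN -mulNr opprB.
Qed.

(** A form of the braid relation for the isobaric operators. Since [f] is symmetric in y_q and y_r
    it is fixed by D_qr, so D_qr D_pq f = D_qr D_pq D_qr f = D_pq D_qr D_pq f, and every image of
    D_pq is symmetric in y_p and y_q. The proof checks this directly on the three values of [f] that
    remain. *)
Lemma braid_sym_left (p q r : 'I_n) f y :
  p != q -> p != r -> q != r -> injective y ->
  (forall z, injective z -> f (z \o tperm q r) = f z) ->
  divdiff q r (divdiff p q f) (y \o tperm p q) = divdiff q r (divdiff p q f) y.
Proof.
move=> pq pr qr yi fs.
rewrite /divdiff /= !(tpermL, tpermR) tperm_comp2 !(@tpermD _ q r p) 1?eq_sym
  //.
rewrite !(@tpermD _ p q r) // !tpermL (@fs y) // (fs (y \o _));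
  last exact: inj_tperm.
rewrite tperm_braid // (fs ((y \o _) \o _)); last by do 2!apply: inj_tperm.
set A := f y; set B := f (_ \o _); set C := f _.
have yy a b : a != b -> y a - y b != 0.
  by move=> ab; rewrite subr_eq0; apply: contra_neq ab; apply: yi.
by field; rewrite !yy // eq_sym.
Qed.

Lemma braid_sym_right (p q r : 'I_n) f y :
  p != q -> p != r -> q != r -> injective y ->
  (forall z, injective z -> f (z \o tperm p q) = f z) ->
  divdiff p q (divdiff q r f) (y \o tperm q r) = divdiff p q (divdiff q r f) y.
Proof.
move=> pq pr qr yi fs.
rewrite /divdiff /= !(tpermL, tpermR) tperm_comp2 !(@tpermD _ q r p) 1?eq_sym
  //.
rewrite !(@tpermD _ p q r) // !tpermR (@fs y) // (fs (y \o _));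
  last exact: inj_tperm.
rewrite -tperm_braid // (fs ((y \o _) \o _)); last by do 2!apply: inj_tperm.
set A := f y; set B := f (_ \o _); set C := f _.
have yy a b : a != b -> y a - y b != 0.
  by move=> ab; rewrite subr_eq0; apply: contra_neq ab; apply: yi.
by field; rewrite !yy // eq_sym.
Qed.

Lemma Gtop_sym (i j : 'I_n) x y : (i < n - k)%N = (j < n - k)%N ->
  Gtop x (y \o tperm i j) = Gtop x y.
Proof.
move=> ij; rewrite /Gtop; apply: eq_bigr => a _.
rewrite [RHS](reindex_inj (@perm_inj _ (tperm i j))) /=.
by apply: eq_bigl => b; case: tpermP => // ->.
Qed.

Lemma in_move l i j a : a \in move l i j = (a == j) || (a != i) && (a \in l).
Proof. by rewrite !inE. Qed.

Lemma card_move l i j : addable l (i, j) -> #|move l i j| = #|l|.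
Proof.
case/and3P=> /= /eqP ij il jl.
rewrite /move cardsU1 !inE (negbTE jl) andbF add1n.
by rewrite [in RHS](cardsD1 i) il.
Qed.

(** A move away from [i] and [j] commutes with their exchange. A move that touches one of them can
    be followed by a second move that touches both, and then the braid relation applies. *)
Lemma Gup_sym l (i j : 'I_n) x y : #|l| = k -> injective y ->
  j = i.+1 :> nat -> (i \in l) = (j \in l) ->
  Gup l x (y \o tperm i j) = Gup l x y.
Proof.
move=> lk yi ij; elim/addable_ind: l => [l na|l a b ad IH] in y lk yi i j ij *.
  move=> e; rewrite !Gup_noadd // Gtop_sym //.
  by move: e; rewrite (noadd_top na) lk !inE !(leqNgt (n - k)) => /negb_inj.
move=> e; have [/eqP ab al bl] := and3P ad; rewrite /= in ab al bl.
rewrite !(Gup_add _ _ ad).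
have nij : i != j by apply/eqP => /(congr1 val) /=; lia.
have nab : a != b by apply/eqP => /(congr1 val) /=; lia.
have ai : a != i by apply: contraNneq bl => ai;
  rewrite (val_inj (_ : b = j :> nat)) -?e -?ai // ab ij ai.
have bj : b != j by apply: contra_neq ai => bj; apply: val_inj => /=;
  move: ab; rewrite bj ij => -[].
have cm := codepth_move ad.
(* Both [i] and [j] are in [l]: once [j] has moved to [b], [i] can move to [j], and the result
   contains both [j] and [b]. *)
have [aj|aj] := eqVneq a j.
  subst a; have ib : i != b by apply/eqP => /(congr1 val) /=; lia.
  have ad2 : addable (move l j b) (i, j).
    by rewrite /addable /= ij eqxx /= !in_move (negbTE nij) eqxx (negbTE ib)
      (negbTE nab) e al.
  have cm2 := codepth_move ad2.
  rewrite !(@divdiff_ext _ _ j b _ _ _ (fun z => Gup_add x z ad2)).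
  apply: braid_sym_left => // z zi; apply: IH => //;
    first by rewrite cm cm2 ltnS leqnSn.
    by rewrite !card_move.
  by rewrite !in_move !eqxx /= (eq_sym b i) ib orbT.
(* Neither [i] nor [j] is in [l]: the element moved from [a] to [i] can go on to [j], and the result
   contains neither [a] nor [i]. *)
have [bi|bi] := eqVneq b i.
  subst b.
  have ad2 : addable (move l a i) (i, j).
    by rewrite /addable /= ij eqxx /= !in_move eqxx (eq_sym j) (negbTE nij) -e
      (negbTE bl) !andbF.
  have cm2 := codepth_move ad2.
  rewrite !(@divdiff_ext _ _ a i _ _ _ (fun z => Gup_add x z ad2)).
  apply: braid_sym_right => // z zi; apply: IH => //;
    first by rewrite cm cm2 ltnS leqnSn.
    by rewrite !card_move.
  by rewrite !in_move !eqxx (negbTE nab) (negbTE aj) (negbTE nij) /= ?andbF.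
have E z : injective z -> Gup (move l a b) x (z \o tperm i j) = Gup (move l a
  b) x z.
  move=> zi; apply: IH => //; first by rewrite cm.
    by rewrite card_move.
  by rewrite !in_move (eq_sym i b) (eq_sym j b) (eq_sym i a) (eq_sym j a)
    (negbTE bi) (negbTE bj) ai aj.
rewrite /divdiff /= !(@tpermD _ i j) 1?eq_sym // tperm_compC // !E //.
exact: inj_tperm.
Qed.

(** [Gdown] before conjugation of the frame and reversal of the variables, see [Gdown_Hup]. With
    this monomial factor the exchange coefficients are exactly those of [Rright]. *)
Definition Hup l x y : F :=
  (\prod_(i < k) x i) * (\prod_(i in l) (y i)^-1) * Gup l x y.

Lemma Hup_sym l (i j : 'I_n) x y : #|l| = k -> injective y ->
  j = i.+1 :> nat -> (i \in l) = (j \in l) ->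
  Hup l x (y \o tperm i j) = Hup l x y.
Proof.
move=> lk yi ij e; rewrite /Hup Gup_sym //; congr (_ * _ * _).
rewrite [RHS](reindex_inj (@perm_inj _ (tperm i j))) /=.
by apply: eq_bigl => b; case: tpermP => // ->.
Qed.

(** [Gup l] is an image of the divided difference, hence symmetric in the two variables; only the
    monomial factor changes. *)
Lemma Hup_lower l (i j : 'I_n) x y : injective y -> (forall a, y a != 0) ->
  addable l (i, j) ->
  Hup l x (y \o tperm i j) = y i / y j * Hup l x y.
Proof.
move=> yi y0 ad; have [/eqP ij il jl] := and3P ad; rewrite /= in ij il jl.
have nij : i != j by apply: contraNneq jl => <-.
have E : \prod_(a in l) ((y \o tperm i j) a)^-1
       = y i / y j * \prod_(a in l) (y a)^-1.
  rewrite (big_setD1 i il) [in RHS](big_setD1 i il) /= tpermL.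
  rewrite (eq_bigr (fun a => (y a)^-1)); first by field; rewrite !y0.
  move=> a; rewrite !inE => /andP[ai al]; rewrite tpermD 1?eq_sym //.
  by apply: contraNneq jl => <-.
rewrite /Hup E !(Gup_add _ _ ad) divdiff_sym //; ring.
Qed.

(** The defining relation of the divided difference, solved for the value at the exchanged
    variables. *)
Lemma Hup_upper l (i j : 'I_n) x y : injective y -> (forall a, y a != 0) ->
  addable l (i, j) ->
  Hup (move l i j) x (y \o tperm i j)
  = Hup (move l i j) x y + (1 - y i / y j) * Hup l x y.
Proof.
move=> yi y0 ad; have [/eqP ij il jl] := and3P ad; rewrite /= in ij il jl.
have nij : i != j by apply: contraNneq jl => <-.
rewrite /Hup (Gup_add _ _ ad) /divdiff.
have jl' : j \notin l :\ i by rewrite !inE negb_and jl orbT.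
rewrite (big_setD1 i il) /move !(big_setU1 _ jl') /= tpermR.
rewrite (eq_bigr (fun a => (y a)^-1)); last first.
  move=> a; rewrite !inE => /andP[ai al]; rewrite tpermD 1?eq_sym //.
  by apply: contraNneq jl => <-.
have yy : y i - y j != 0.
  by rewrite subr_eq0; apply: contra_neq nij; apply: yi.
by field; rewrite !y0 yy.
Qed.

End Exchange.

(** * Removing the first variable *)

Section FirstVariable.

Definition behead_set n (v : {set 'I_n.+1}) : {set 'I_n} :=
  [set i | lift ord0 i \in v].

Lemma card_behead_set n (v : {set 'I_n.+1}) :
  #|v| = ((ord0 \in v) + #|behead_set v|)%N.
Proof.
rewrite -!sum1_card big_mkcond big_ord_recl /= -[X in (_ + X)%N]big_mkcond /=.
by congr (_ + _)%N; apply: eq_bigl => i; rewrite inE.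
Qed.

Lemma lift0_comp_tperm n (z : 'I_n.+1 -> F) (i j : 'I_n) :
  (z \o tperm (lift ord0 i) (lift ord0 j)) \o lift ord0
  = (z \o lift ord0) \o tperm i j.
Proof.
apply: functional_extensionality => a /=; congr (z _).
case: (tpermP i j a) => [->|->|/eqP ai /eqP aj]; rewrite ?tpermL ?tpermR //.
by rewrite tpermD // eq_sym (inj_eq lift_inj).
Qed.

Lemma addable_lift0 n (v : {set 'I_n.+1}) (i j : 'I_n) :
  addable v (lift ord0 i, lift ord0 j) = addable (behead_set v) (i, j).
Proof. by rewrite /addable /= !inE /bump /= !add1n eqSS. Qed.

Lemma behead_move n (v : {set 'I_n.+1}) (i j : 'I_n) :
  behead_set (move v (lift ord0 i) (lift ord0 j)) = move (behead_set v) i j.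
Proof. by apply/setP=> a; rewrite !inE !(inj_eq lift_inj). Qed.

(** Frame elements only move to the right, so an empty first position stays empty and its variable
    is never exchanged. It contributes just its column of [Gtop]. *)
Lemma Gup_out k n (v : {set 'I_n.+1}) (x : 'I_k -> F) z : (k <= n)%N ->
  ord0 \notin v ->
  Gup v x z = \prod_a (1 - x a / z ord0)
              * Gup (behead_set v) x (z \o lift ord0).
Proof.
move=> kn; elim/addable_ind: v z => [v na|v i j ad IH] z v0.
  rewrite !Gup_noadd //; last by case=> i j; rewrite -addable_lift0.
  rewrite /Gtop -big_split; apply: eq_bigr => a _ /=.
  rewrite big_mkcond big_ord_recl /= subn_gt0 ltnS kn; congr (_ * _).
  by rewrite [RHS]big_mkcond; apply: eq_bigr => j _;
    rewrite /bump /= add1n subSn.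
have [/eqP ij il jl] := and3P ad; rewrite /= in ij il jl.
have [i' ei|ei] := unliftP ord0 i; last by rewrite ei (negbTE v0) in il.
have [j' ej|ej] := unliftP ord0 j; last by move: ij; rewrite ej.
subst i j; rewrite (Gup_add _ _ ad) (Gup_add _ _ (i := i') (j := j'));
  last first.
  by rewrite -addable_lift0.
have v0' : ord0 \notin move v (lift ord0 i') (lift ord0 j').
  by rewrite in_move (negbTE v0) andbF.
have lt := codepth_move ad.
rewrite /divdiff !IH ?lt // behead_move lift0_comp_tperm /= tpermD //.
ring.
Qed.

(** The variable [z j], below the whole frame, is never exchanged, and [Gtop] contains the factor 1
    - x a / z j, which is 0. *)
Lemma Gup_vanish k n (l : {set 'I_n}) (x : 'I_k -> F) z a (j : 'I_n) :
  #|l| = k -> z j != 0 -> x a = z j -> (forall i, i \in l -> (j < i)%N) ->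
  Gup l x z = 0.
Proof.
elim/addable_ind: l z => [l na|l i i' ad IH] z lk zj xa lj.
  rewrite Gup_noadd // /Gtop (bigD1 a) //= (bigD1 j) /=; last first.
    rewrite ltnNge; apply/negP => jk; have := lj j.
    by rewrite (noadd_top na) inE lk jk ltnn => /(_ isT).
  by rewrite xa divff // subrr !mul0r.
have [/eqP ij il jl] := and3P ad; rewrite /= in ij il jl.
have lt := codepth_move ad; have ji := lj i il.
have lj' b : b \in move l i i' -> (j < b)%N.
  by rewrite in_move => /orP[/eqP->|/andP[_ /lj]//]; rewrite ij ltnS ltnW.
have fixj : tperm i i' j = j.
  by rewrite tpermD //; apply/eqP => e; move: ji;
    rewrite -e ?ij ltnNge ?leqnSn ?leqnn.
rewrite (Gup_add _ _ ad) /divdiff !IH ?lt ?card_move //= ?fixj //.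
by rewrite !mulr0 subrr mul0r.
Qed.

(** The frames obtained from the full rectangle by moving only its lowest element to the left. As
    [x ord0 = z j], one of the two terms of each divided difference is 0 by [Gup_vanish], so the
    value remains a product. *)
Lemma Gup_chain k n (l : {set 'I_n}) (x : 'I_k.+1 -> F) z (j : 'I_n) :
  #|l| = k.+1 -> injective z -> (forall i, z i != 0) -> (k < n)%N ->
  (j <= n - k.+1)%N -> l = j |: [set i : 'I_n | (n - k.+1 < i)%N] ->
  x ord0 = z j ->
  Gup l x z
  = (\prod_(a < k) \prod_(i < n | (i <= n - k.+1)%N && (i != j))
       (1 - x (lift ord0 a) / z i))
    * \prod_(i < n | (i < j)%N) (1 - z j / z i).
Proof.
move=> lk zi z0 kn; have [m] := ubnP (n - k.+1 - j)%N.
elim: m => // m IH in l z j lk zi z0 *; rewrite ltnS => jm jt el xj.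
have [ejt|jt'] := eqVneq (j : nat) (n - k.+1)%N.
  rewrite Gup_top; last first.
    by apply/setP=> i; rewrite el !inE -ejt [RHS]leq_eqVlt -val_eqE eq_sym.
  rewrite /Gtop big_ord_recl mulrC xj ejt; congr (_ * _).
  by apply: eq_bigr => a _; apply: eq_bigl => i; rewrite ltn_neqAle andbC -ejt.
have {}jt' : (j < n - k.+1)%N by rewrite ltn_neqAle jt'.
have jn : (j.+1 < n)%N by apply: leq_ltn_trans jt' _; rewrite ltn_subrL; lia.
pose j' := Ordinal jn.
have nj : j != j' by apply/eqP => /(congr1 val) /=; lia.
have ad : addable l (j, j').
  by rewrite /addable /= eqxx el !inE eqxx (eq_sym j') (negbTE nj) /= -leqNgt.
have em : move l j j' = j' |: [set i : 'I_n | (n - k.+1 < i)%N].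
  apply/setP=> i; rewrite el in_move !inE; case: eqVneq => //= _.
  by case: eqVneq => //= ->; rewrite ltnNge jt.
rewrite (Gup_add _ _ ad) /divdiff (Gup_vanish (a := ord0) (j := j)) //;
  last first.
- by move=> i; rewrite em !inE => /orP[/eqP-> //=|]; apply: leq_ltn_trans.
- by rewrite card_move.
rewrite (IH _ _ j') ?card_move //=; last first.
- by rewrite tpermR.
- by rewrite subnS -ltnS prednK // subn_gt0.
- exact: inj_tperm.
have -> : \prod_(a < k) \prod_(i < n | (i <= n - k.+1)%N && (i != j'))
      (1 - x (lift ord0 a) / z (tperm j j' i))
   = \prod_(a < k) \prod_(i < n | (i <= n - k.+1)%N && (i != j))
      (1 - x (lift ord0 a) / z i).
  apply: eq_bigr => a _; rewrite (reindex_inj (@perm_inj _ (tperm j j'))) /=.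
  apply: eq_big => [i|i _]; last by rewrite tpermK.
  case: tpermP => [->|->|/eqP ij /eqP ij']; rewrite ?eqxx ?andbF //.
    by rewrite jt nj jt' eq_sym nj.
  by rewrite ij ij'.
(* The factor 1 - z j / z j' split off here cancels the coefficient - z j' / (z j - z j') of the
   surviving term. *)
rewrite tpermR [\prod_(i < n | (i < j.+1)%N) _](bigD1 j) //= tpermL.
have -> : \prod_(i < n | (i < j.+1)%N && (i != j)) (1 - z j / z (tperm j j' i))
  = \prod_(i < n | (i < j)%N) (1 - z j / z i).
  apply: eq_big => [i|i /andP[lt ij]]; first by rewrite ltnS [RHS]ltn_neqAle
    andbC.
  rewrite tpermD // 1?eq_sym //; apply/eqP => /(congr1 val) /= e.
  by move: lt; rewrite e ltnn.
have zz : z j - z j' != 0.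
  by rewrite subr_eq0; apply: contra_neq nj; apply: zi.
by field; rewrite !z0 zz.
Qed.

(** The first frame element never has to move: the recursion runs on [behead_set v] alone and ends
    at a frame made of the first position and a final segment, which is [Gup_chain] with j = 0. *)
Lemma Gup_in k n (v : {set 'I_n.+1}) (x : 'I_k.+1 -> F) z :
  #|v| = k.+1 -> injective z -> (forall i, z i != 0) ->
  ord0 \in v -> x ord0 = z ord0 ->
  Gup v x z = Gup (behead_set v) (x \o lift ord0) (z \o lift ord0).
Proof.
move: {2}(behead_set v) (erefl (behead_set v)) => w.
elim/addable_ind: w v z => [w na|w i j ad IH] v z ew vk zi z0 v0 xz.
  have wk : #|w| = k by move: vk; rewrite card_behead_set v0 ew add1n => -[].
  have kn : (k <= n)%N by rewrite -wk (leq_trans (max_card _)) ?card_ord.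
  rewrite ew (Gup_noadd _ _ na) (@Gup_chain _ _ v x z ord0) //.
    rewrite [X in _ * X]big_pred0 // mulr1 /Gtop subSS; apply: eq_bigr => a _.
    rewrite big_mkcond big_ord_recl /= mul1r [RHS]big_mkcond.
    by apply: eq_bigr => i _; rewrite /bump /= add1n ?subSS ?andbT.
  apply/setP=> i; rewrite !inE; case: (unliftP ord0 i) => [i' ->|->];
    last by rewrite v0 eqxx.
  have := noadd_top na; rewrite wk -ew => /setP /(_ i'); rewrite !inE => ->.
  by rewrite subSS.
have ad' : addable v (lift ord0 i, lift ord0 j) by rewrite addable_lift0 ew.
have ad2 : addable (behead_set v) (i, j) by rewrite ew.
rewrite (Gup_add _ _ ad') (Gup_add _ _ ad2) /divdiff.
have lt := codepth_move ad.
rewrite !(IH (move w i j)) ?lt ?behead_move ?ew ?card_move // ?in_move ?v0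
  ?orbT //.
- by rewrite lift0_comp_tperm.
- exact: inj_tperm.
- by move=> b; apply: z0.
- by rewrite /= tpermD.
Qed.

Lemma prod_behead n (v : {set 'I_n.+1}) (f : 'I_n.+1 -> F) :
  \prod_(i in v) f i
  = (if ord0 \in v then f ord0 else 1) * \prod_(i in behead_set v) f (lift ord0
    i).
Proof.
rewrite big_mkcond big_ord_recl [in RHS]big_mkcond; congr (_ * _).
by apply: eq_bigr => i _; rewrite inE.
Qed.

Lemma Hup_out k n (v : {set 'I_n.+1}) (x : 'I_k -> F) z : (k <= n)%N ->
  ord0 \notin v ->
  Hup v x z = \prod_a (1 - x a / z ord0)
              * Hup (behead_set v) x (z \o lift ord0).
Proof.
by move=> kn v0; rewrite /Hup Gup_out // prod_behead (negbTE v0) mul1r; ring.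
Qed.

Lemma Hup_in k n (v : {set 'I_n.+1}) (x : 'I_k.+1 -> F) z :
  #|v| = k.+1 -> injective z -> (forall i, z i != 0) ->
  ord0 \in v -> x ord0 = z ord0 ->
  Hup v x z = Hup (behead_set v) (x \o lift ord0) (z \o lift ord0).
Proof.
move=> vk zi z0 v0 xz; rewrite /Hup Gup_in // prod_behead v0 big_ord_recl xz /=.
by field; rewrite z0.
Qed.

End FirstVariable.

End GrothendieckPolynomials.

(** * The product rule at the fixed points *)

Section Words.

Variable F : fieldType.
Implicit Types (ys ps qs : seq F) (bs : seq bool) (la hs pl : seq state).

Definition generic ys := uniq ys && all (predC1 0) ys.

Lemma generic_perm ys ys' : perm_eq ys ys' -> generic ys = generic ys'.
Proof. by move=> p; rewrite /generic (perm_uniq p) (perm_all _ p). Qed.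

Lemma perm_swap2 ps (y1 y2 : F) qs :
  perm_eq (ps ++ y1 :: y2 :: qs) (ps ++ y2 :: y1 :: qs).
Proof. by rewrite perm_cat2l -(cat1s y1) -(cat1s y2) perm_catCA. Qed.

(** Frames are words here, since exchanging and removing variables change the list [ys]. Words of
    the wrong length or weight get 0, so that sums over all words make sense. *)
Definition Hword k (x : 'I_k -> F) ys bs : F :=
  if (size bs == size ys) && (count id bs == k) then
    Hup [set i : 'I_(size ys) | nth false bs i] x (fun i => nth 0 ys i)
  else 0.

Lemma HwordE k n (x : 'I_k -> F) ys bs : size ys = n -> size bs = n ->
  count id bs = k ->
  Hword x ys bs = Hup [set i : 'I_n | nth false bs i] x (fun i => nth 0 ys i).
Proof. by move=> <- sb cb; rewrite /Hword sb cb !eqxx. Qed.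

Lemma card_word n bs : size bs = n ->
  #|[set i : 'I_n | nth false bs i]| = count id bs.
Proof.
move=> sb; rewrite -sum1_card -sum1_count (big_nth false) big_mkord sb.
by apply: eq_bigl => i; rewrite inE.
Qed.

(** The exchange matrix of [Hup]. It is [Rright] on the letters O and G and [Rtop] on R and G, with
    G as [true]; on O and R, with O as [true] and the order of the letters reversed, it is
    [Rleft]. *)
Definition Rword (r : F) (X : bool -> bool -> F) a b : F :=
  match a, b with
  | false, true => X false true + (1 - r) * X true false
  | true, false => r * X true false
  | _, _ => X a b
  end.

Lemma Hword_exchange k (x : 'I_k -> F) ps y1 y2 qs p b1 b2 q :
  generic (ps ++ y1 :: y2 :: qs) -> size p = size ps ->
  Hword x (ps ++ y2 :: y1 :: qs) (p ++ b1 :: b2 :: q)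
  = Rword (y1 / y2)
      (fun b1 b2 => Hword x (ps ++ y1 :: y2 :: qs) (p ++ b1 :: b2 :: q)) b1 b2.
Proof.
move=> /andP[un ne] sp; set ys := ps ++ y1 :: y2 :: qs in un ne *.
(* Words of the wrong length, and below those of the wrong weight, give 0 on both sides. *)
have [sq|sq] := eqVneq (size q) (size qs); last first.
  have H b b' y y' : Hword x (ps ++ y :: y' :: qs) (p ++ b :: b' :: q) = 0.
    by rewrite /Hword !size_cat /= sp eqn_add2l !eqSS (negbTE sq).
  by case: b1 b2 => [] []; rewrite /= !H ?mulr0 ?addr0.
have [cq|cq] := eqVneq (b1 + (b2 + (count id p + count id q)))%N k; last first.
  have H (b b' : bool) y y' : (b + b' = b1 + b2)%N ->
      Hword x (ps ++ y :: y' :: qs) (p ++ b :: b' :: q) = 0.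
    move=> e; rewrite /Hword !size_cat /= sp sq eqxx !count_cat /=.
    rewrite [(count id p + _)%N]addnCA [(count id p + _)%N]addnCA addnA e
      -addnA.
    by rewrite (negbTE cq).
  by case: b1 b2 {cq} H => [] [] H; rewrite /= !H ?mulr0 ?addr0.
pose n := size ys.
have lt1 : (size ps < n)%N by rewrite /n size_cat /=; lia.
have lt2 : ((size ps).+1 < n)%N by rewrite /n size_cat /=; lia.
pose i := Ordinal lt1; pose j := Ordinal lt2.
pose Y (a : 'I_n) := nth 0 ys a.
pose L b b' := [set a : 'I_n | nth false (p ++ b :: b' :: q) a].
have Y0 a : Y a != 0 by apply: (allP ne); apply: mem_nth.
have Yi : injective Y.
  by move=> a b /eqP; rewrite nth_uniq // => /eqP /val_inj.
have nthp (T : Type) (d : T) s s1 s2 s3 :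
    (nth d (s ++ s1 :: s2 :: s3) (size s) = s1)
  * (nth d (s ++ s1 :: s2 :: s3) (size s).+1 = s2).
  by rewrite !nth_cat ltnn subnn ltnNge leqnSn /= subSn // subnn.
have Yij : (Y i = y1) * (Y j = y2) by rewrite /Y /ys /= !nthp.
have nth_out (T : Type) (d : T) s s1 s2 t1 t2 s3 (a : nat) : a <> size s ->
    a <> (size s).+1 ->
    nth d (s ++ s1 :: s2 :: s3) a = nth d (s ++ t1 :: t2 :: s3) a.
  move=> a1 a2; rewrite !nth_cat; case: ltnP => // sa.
  by case E: (a - size s)%N => [|[|c]] //; lia.
have Ysw : (fun a : 'I_n => nth 0 (ps ++ y2 :: y1 :: qs) a) = Y \o tperm i j.
  apply: functional_extensionality => a /=.
  case: tpermP => [->|->|ai aj]; rewrite /= ?nthp ?Yij //.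
  by apply: nth_out => e; [apply: ai | apply: aj]; apply: val_inj.
have HL (b b' : bool) : (b + b' = b1 + b2)%N ->
  (Hword x (ps ++ y2 :: y1 :: qs) (p ++ b :: b' :: q)
     = Hup (L b b') x (Y \o tperm i j))
  * (Hword x ys (p ++ b :: b' :: q) = Hup (L b b') x Y) * (#|L b b'| = k).
  move=> e.
  have sz : size (p ++ b :: b' :: q) = n by rewrite /n !size_cat /= sp sq.
  have ck : count id (p ++ b :: b' :: q) = k.
    by rewrite count_cat /= -cq; lia.
  rewrite (HwordE (n := n) _ _ sz ck); last by rewrite /n !size_cat.
  by rewrite (HwordE (n := n) _ _ sz ck) // Ysw card_word.
have Lij b b' : (i \in L b b' = b) * (j \in L b b' = b').
  by rewrite !inE /= -sp !nthp.
have ad : addable (L true false) (i, j) by rewrite /addable /= eqxx !Lij.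
have mv : move (L true false) i j = L false true.
  apply/setP=> a; rewrite in_move.
  have [->|aj] := eqVneq a j; first by rewrite !Lij ?eqxx.
  have [->|ai] := eqVneq a i; first by rewrite !Lij ?eqxx ?andbF.
  rewrite !inE; apply: nth_out => e; [case/eqP: ai | case/eqP: aj];
    by apply: val_inj; rewrite /= e sp.
case: b1 b2 HL {cq} => [] [] HL; rewrite /= !HL //.
- by rewrite Hup_sym ?Lij ?HL.
- by rewrite Hup_lower // !Yij.
- by rewrite -mv Hup_upper // !Yij.
- by rewrite Hup_sym ?Lij ?HL.
Qed.

Lemma generic_cons y ys :
  generic (y :: ys) = [&& y != 0, y \notin ys & generic ys].
Proof. by rewrite /generic /= -!andbA; do !bool_congr. Qed.

Lemma behead_word n b bs :
  behead_set [set i : 'I_n.+1 | nth false (b :: bs) i]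
  = [set i : 'I_n | nth false bs i].
Proof. by apply/setP=> i; rewrite !inE. Qed.

Lemma Hword_in k (x : 'I_k.+1 -> F) y ys bs : generic (y :: ys) ->
  x ord0 = y ->
  Hword x (y :: ys) (true :: bs) = Hword (x \o lift ord0) ys bs.
Proof.
move=> /andP[un ne] xy; rewrite /Hword /= eqSS add1n eqSS.
case: ifP => // /andP[/eqP sb /eqP cb].
rewrite Hup_in ?behead_word ?inE //.
- by rewrite card_word /= ?sb ?cb.
- by move=> a b /eqP; rewrite nth_uniq // => /eqP /val_inj.
- by move=> a; apply: (allP ne); apply: mem_nth.
Qed.

Lemma Hword_out k (x : 'I_k -> F) y ys bs :
  Hword x (y :: ys) (false :: bs)
  = \prod_a (1 - x a / y) * Hword x ys bs.
Proof.
rewrite /Hword /= eqSS add0n; case: ifP => [/andP[/eqP sb /eqP cb]|];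
  last first.
  by rewrite mulr0.
rewrite Hup_out ?behead_word ?inE //.
by rewrite -cb -sb count_size.
Qed.

Lemma Hword_out0 k (x : 'I_k.+1 -> F) y ys bs : y != 0 -> x ord0 = y ->
  Hword x (y :: ys) (false :: bs) = 0.
Proof.
by move=> y0 xy; rewrite Hword_out big_ord_recl xy divff // subrr !mul0r.
Qed.

Lemma Hword0 (x : 'I_0 -> F) ys bs :
  Hword x ys bs = ((size bs == size ys) && all negb bs)%:R.
Proof.
elim: ys bs => [|y ys IH] [|b bs] //.
  rewrite /Hword /= /Hup Gup_noadd; last by case=> -[].
  by rewrite /Gtop !big_ord0 !mulr1.
case: b; first by rewrite /Hword /= add1n !andbF.
by rewrite Hword_out big_ord0 mul1r IH.
Qed.

Definition left_state s := (s == O) || (s == R).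
Definition right_state s := (s == O) || (s == G).

(** The reversals account for the conjugation and the reversed variables in [Gdown]. None is left in
    [Hright], because the right word is read upwards and its polynomial is taken at the reversed
    variables. *)
Definition Hleft k (x : 'I_k -> F) ys la : F :=
  if all left_state la then Hword x (rev ys) (rev [seq s == O | s <- la])
  else 0.

Definition Hright k (x : 'I_k -> F) ys vs : F :=
  if all right_state vs then Hword x ys [seq s == G | s <- vs] else 0.

(** Beyond [Hword_exchange], the extension by zero has to be respected: an R-matrix only permutes
    the two letters, so a forbidden state remains present in every term. *)
Lemma Hleft_exchange k (x : 'I_k -> F) ps y1 y2 qs p l1 l2 q :
  generic (ps ++ y1 :: y2 :: qs) -> size p = size ps -> size q = size qs ->
  Hleft x (ps ++ y2 :: y1 :: qs) (p ++ l1 :: l2 :: q)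
  = Rleft (y2 / y1)
      (fun l1 l2 => Hleft x (ps ++ y1 :: y2 :: qs) (p ++ l1 :: l2 :: q)) l1 l2.
Proof.
move=> ge sp sq; rewrite /Hleft.
have rv (T : Type) (s t : seq T) a b :
    rev (s ++ a :: b :: t) = rev t ++ b :: a :: rev s.
  by rewrite rev_cat !rev_cons !cat_rcons.
have ge' : generic (rev qs ++ y1 :: y2 :: rev ps).
  rewrite -(generic_perm (perm_swap2 _ _ _ _)) -rv (generic_perm (ys' := ps ++
    y1 :: y2 :: qs)) //.
  by rewrite perm_rev.
have ge2 := ge'; rewrite (generic_perm (perm_swap2 _ _ _ _)) in ge2.
have E b1 b2 : Hword x (rev qs ++ y1 :: y2 :: rev ps)
   (rev [seq s == O | s <- q] ++ b1 :: b2 :: rev [seq s == O | s <- p])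
 = Rword (y2 / y1) (fun b1 b2 => Hword x (rev qs ++ y2 :: y1 :: rev ps)
   (rev [seq s == O | s <- q] ++ b1 :: b2 :: rev [seq s == O | s <- p])) b1 b2.
  by apply: Hword_exchange => //; rewrite !size_rev size_map.
have A l l' : all left_state (p ++ l :: l' :: q)
   = (all left_state p && all left_state q) && (left_state l && left_state l').
  by rewrite all_cat /= [_ l && _]andbA [_ && all _ q]andbC andbA.
case: (boolP (all left_state p && all left_state q)) A => [_|_] A; last first.
  by case: l1 l2 => [[] []] [[] []] /=; rewrite !A ?mulr0 ?addr0.
by case: l1 l2 => [[] []] [[] []] /=; rewrite ?A /= ?mulr0 ?addr0 // !map_cat
  /= !rv E.
Qed.

Lemma Hright_exchange k (x : 'I_k -> F) ps y1 y2 qs p l1 l2 q :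
  generic (ps ++ y1 :: y2 :: qs) -> size p = size ps ->
  Hright x (ps ++ y2 :: y1 :: qs) (p ++ l1 :: l2 :: q)
  = Rright (y1 / y2)
      (fun l1 l2 => Hright x (ps ++ y1 :: y2 :: qs) (p ++ l1 :: l2 :: q)) l1 l2.
Proof.
move=> ge sp; rewrite /Hright.
have A l l' : all right_state (p ++ l :: l' :: q)
   = (all right_state p && all right_state q) && (right_state l && right_state
     l').
  by rewrite all_cat /= [_ l && _]andbA [_ && all _ q]andbC andbA.
case: (boolP (all right_state p && all right_state q)) A => [_|_] A; last first.
  by case: l1 l2 => [[] []] [[] []] /=; rewrite !A ?mulr0 ?addr0.
by case: l1 l2 => [[] []] [[] []] /=; rewrite ?A /= ?mulr0 ?addr0 // !map_cat /=
  Hword_exchange // size_map.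
Qed.

(** On the right side of the puzzle [Hright] sums over all diagrams at once, so no coefficient has
    to be isolated during the exchanges. *)
Definition product_rule k (x : 'I_k -> F) ys : Prop :=
  forall la hs, all left_state la -> all top_state hs ->
    size la = size ys -> size hs = size ys ->
    Hleft x ys la * Hword x ys [seq s == G | s <- hs]
    = puz ys hs (Hright x ys) la.

(** Both sides of the formula are transformed by the same [Rleft] and [Rtop]; for the puzzles this
    is [puz_exchange], whose hypothesis on the right words is [Hright_exchange]. *)
Lemma product_rule_swap k (x : 'I_k -> F) ps y1 y2 qs :
  generic (ps ++ y1 :: y2 :: qs) ->
  product_rule x (ps ++ y1 :: y2 :: qs) ->
  product_rule x (ps ++ y2 :: y1 :: qs).
Proof.
move=> ge S la hs la1 hs1.
case/(@split2 _ _ _ ps qs)=> pl [l1 [l2 [ql [el spl sql]]]].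
case/(@split2 _ _ _ ps qs)=> ph [h1 [h2 [qh [eh sph sqh]]]]; subst la hs.
have {la1}[lp l1o l2o lq] :
  [/\ all left_state pl, left_state l1, left_state l2 & all left_state ql].
  by move: la1; rewrite all_cat /= => /and4P[].
have {hs1}[hp h1o h2o hq] :
  [/\ all top_state ph, top_state h1, top_state h2 & all top_state qh].
  by move: hs1; rewrite all_cat /= => /and4P[].
rewrite Hleft_exchange // map_cat /= Hword_exchange ?size_map //.
rewrite (@puz_exchange F y1 y2 ps qs ph qh pl ql h1 h2 l1 l2
  (Hright x (ps ++ y1 :: y2 :: qs))) //; last first.
- by move=> p q a b sp; apply: Hright_exchange.
- by case/andP: ge.
have SS l l' h h' :
  left_state l -> left_state l' -> top_state h -> top_state h' ->
  puz (ps ++ y1 :: y2 :: qs) (ph ++ h :: h' :: qh)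
    (Hright x (ps ++ y1 :: y2 :: qs)) (pl ++ l :: l' :: ql)
  = Hleft x (ps ++ y1 :: y2 :: qs) (pl ++ l :: l' :: ql) *
    Hword x (ps ++ y1 :: y2 :: qs)
      ([seq s == G | s <- ph]
       ++ (h == G) :: (h' == G) :: [seq s == G | s <- qh]).
  move=> lo lo' ho ho'; rewrite -S ?all_cat /= ?lp ?lo ?lo' ?hp ?ho ?ho' //.
  - by rewrite map_cat.
  - by rewrite !size_cat /= spl sql.
  - by rewrite !size_cat /= sph sqh.
by case: l1 l2 h1 h2 l1o l2o h1o h2o => [[] []] [[] []] [[] []] [[] []] //=
  _ _ _ _; rewrite !SS //=; ring.
Qed.

Lemma puz0 ys hs la : puz ys hs (fun _ => 0 : F) la = 0.
Proof.
elim: ys hs la => [|y ys IH] [|h hs] [|l la] //=.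
transitivity (corner h l (fun _ => 0 : F));
  last by case: h l => [[] []] [[] []].
apply: eq_corner => a; rewrite -[RHS](strip0 y ys a la).
by apply: eq_strip => ka v _; apply: IH.
Qed.

Lemma flow_green_left la : (flow snd la == 0)%N = all (fun s => ~~ s.2) la.
Proof. by elim: la => //= s la IH; rewrite flow_cons addn_eq0 IH;
  case: s.2. Qed.

Lemma left_green la : all left_state la -> flow snd la = 0%N.
Proof.
by move=> l; apply/eqP; rewrite flow_green_left; apply: sub_all l => -[[] []].
Qed.

(** No green enters the strip, so none can leave it. *)
Lemma strip_no_green y1 ys (psi : seq state -> F) la :
  all left_state la ->
  strip y1 ys (fun ka v => if v == G then psi ka else 0) O la = 0.
Proof.
move=> /left_green l; rewrite -[RHS](strip0 y1 ys O la).
apply: (eq_strip_flow (c := snd)); first by right.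
by move=> ka v _; rewrite l; case: eqP => // ->; rewrite addn1.
Qed.

(** An empty edge crosses empty and red letters without changing them. *)
Lemma strip_empty y1 ys (psi : seq state -> F) la :
  all left_state la -> size la = size ys ->
  strip y1 ys (fun ka v => if v == O then psi ka else 0) O la = psi la.
Proof.
elim: ys psi la => [|y ys IH] psi [|l la] //= /andP[lo lao] [s].
by case/orP: lo => /eqP->; rewrite /= (IH (fun ka => psi (_ :: ka))).
Qed.

(* Along the first strip a G a-edge behaves as an empty b-edge, and an RG
   a-edge as a red one: the strip carries the variable y1 of the left word
   from its first to its last position. *)
Lemma strip_Hleft k (x : 'I_k.+1 -> F) y1 ps ys pl la (a : state) :
  generic (y1 :: ps ++ ys) -> x ord0 = y1 -> a.2 ->
  all left_state pl -> all left_state la -> size pl = size ps ->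
  size la = size ys ->
  strip y1 ys (fun ka v =>
    if v == G then Hleft (x \o lift ord0) (ps ++ ys) (pl ++ ka) else 0) a la
  = Hleft x (ps ++ y1 :: ys) (pl ++ (a.1, false) :: la).
Proof.
move=> + xy; elim: ys ps pl la a => [|y ys IH] ps pl [|l la] a // ge ag plo lao
  sp sl.
  rewrite cats0 in ge; rewrite /= !cats0 !cats1 /Hleft all_rcons map_rcons.
  have ge' : generic (y1 :: rev ps).
    by rewrite (generic_perm (ys' := y1 :: ps)) // perm_cons perm_rev.
  rewrite !rev_rcons plo; case: a ag => -[] [] //= _.
    by rewrite Hword_out0 //; move: ge; rewrite generic_cons => /and3P[].
  by rewrite Hword_in.
have {lao}/andP[lo lao] := lao; case: sl => sl.
have IH' (k' a' : state) : left_state k' -> a'.2 ->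
  strip y1 ys (fun ka v =>
    if v == G then Hleft (x \o lift ord0) (ps ++ y :: ys) (pl ++ k' :: ka) else
      0) a' la
  = Hleft x (ps ++ y :: y1 :: ys) (pl ++ k' :: (a'.1, false) :: la).
  move=> ko' ao'; have := IH (rcons ps y) (rcons pl k') la a'.
  rewrite !cat_rcons all_rcons !size_rcons ko' sp => <- //.
  by apply: eq_strip => ka v _; rewrite cat_rcons.
have ge2 : generic (ps ++ y :: y1 :: ys).
  rewrite (generic_perm (ys' := y1 :: ps ++ y :: ys)) //.
  rewrite -(cat_rcons y ps (y1 :: ys)) -(cat_rcons y ps ys); apply/permPl.
  exact: (perm_catCA (rcons ps y) [:: y1] ys).
rewrite (@Hleft_exchange _ x ps y y1 ys pl (a.1, false) l la ge2 sp sl) /=.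
(* An outcome with RG on the right of the lozenge leaves O on the strip, which can no longer end in
   G. *)
have z := strip_no_green y1 ys (fun ka => Hleft (x \o lift ord0) (ps ++ y ::
  ys) (pl ++ RG :: ka)) lao.
case: a ag => -[] [] //= _; case: l lo => -[] [] //= _; rewrite ?z ?IH' //=;
  ring.
Qed.

(** While k > 0, a right word whose first letter is not G has value 0, since x and [ys] share their
    first entry; once k = 0, only O remains. With its end thus prescribed, the first strip acts
    explicitly, by [strip_Hleft] or by [strip_empty]. *)
Lemma product_rule_first k (x : 'I_k -> F) ys : generic ys -> (k <= size ys)%N
  ->
  (forall a, x a = nth 0 ys a) -> product_rule x ys.
Proof.
elim: k x ys => [|k IHk] x ys.
  elim: ys => [|y ys IH] ge _ xy [|l la] [|h hs] //.
    by move=> _ _ _ _; rewrite /Hleft /Hright /= !Hword0 mulr1.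
  move=> /andP[lo lao] /andP[ho hso] [sl] [sh].
  have {}lao : all left_state la := lao.
  have {}IH : product_rule x ys.
    by apply: IH => //; [move: ge; rewrite generic_cons => /and3P[] | case].
  have E : (fun v => fun vs => Hright x (y :: ys) (v :: vs)) =
           fun v vs => if v == O then Hright x ys vs else 0.
    apply: functional_extensionality => v;
      apply: functional_extensionality => vs.
    by rewrite /Hright; case: v => -[] [] //=; case: ifP => //;
      rewrite !Hword0 //= ?andbF ?eqSS.
  have E2 v ka : puz ys hs (fun vs => Hright x (y :: ys) (v :: vs)) ka =
    if v == O then puz ys hs (Hright x ys) ka else 0.
    rewrite -[fun vs => _]/((fun v vs => Hright x (y :: ys) (v :: vs)) v) E.
    by case: (v == O) => //; rewrite puz0.
  have -> : puz (y :: ys) (h :: hs) (Hright x (y :: ys)) (l :: la)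
    = corner h l (fun a => strip y ys (fun ka v =>
        if v == O then puz ys hs (Hright x ys) ka else 0) a la).
    by apply: eq_corner => a; apply: eq_strip => ka v _.
  (* Green that enters this strip but does not leave at its end passes into the smaller puzzle and
     reaches the right side, where k = 0 forbids it. *)
  have S0 (a : state) : a.2 -> strip y ys (fun ka v =>
        if v == O then puz ys hs (Hright x ys) ka else 0) a la = 0.
    move=> ag; rewrite -[RHS](strip0 y ys a la).
    apply: (eq_strip_flow (c := snd)); first by right.
    move=> ka v ska; case: eqP => // ->; rewrite ag (left_green lao) /= => fk.
    rewrite -[RHS](puz0 ys hs ka); apply: eq_puz_green => vs sv.
    rewrite /Hright; case: ifP => // vo; rewrite Hword0 => fv.
    suff -> : all negb [seq s == G | s <- vs] = false by rewrite andbF.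
    apply/negP; rewrite all_map => an.
    suff : flow snd vs == 0%N by rewrite fv; lia.
    rewrite flow_green_left; apply/allP => s sv'.
    by move/allP: an => /(_ s sv') /=; move/allP: vo => /(_ s sv');
      case: s {sv'} => -[] [].
  case/orP: ho => /eqP->; last first.
    rewrite /= [X in _ * X]Hword0 andbF mulr0.
    by case/orP: lo => /eqP-> /=; rewrite S0.
  case/orP: lo => /eqP-> /=.
    rewrite /Hleft /=; case: ifP => _; last by rewrite mul0r.
    by rewrite !rev_cons Hword0 all_rcons /= andbF mul0r.
  rewrite strip_empty // -IH // /Hleft /= lao !Hword0 !rev_cons all_rcons /=.
  by rewrite !size_rcons !size_rev !size_map /= !eqSS.
case: ys => // y ys ge; rewrite ltnS => ks xy [|l la] [|h hs] //.
move=> /andP[lo lao] /andP[ho hso] [sl] [sh].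
have {}lao : all left_state la := lao.
have [y0 _ ge'] : [/\ y != 0, y \notin ys & generic ys].
  by apply/and3P; rewrite -generic_cons.
have x0 : x ord0 = y by rewrite xy.
have {}IH : product_rule (x \o lift ord0) ys.
  by apply: IHk => // a; rewrite /= xy.
have E2 v ka : puz ys hs (fun vs => Hright x (y :: ys) (v :: vs)) ka =
  if v == G then puz ys hs (Hright (x \o lift ord0) ys) ka else 0.
  have E : (fun vs => Hright x (y :: ys) (v :: vs)) =
    fun vs => if v == G then Hright (x \o lift ord0) ys vs else 0.
    apply: functional_extensionality => vs.
    by rewrite /Hright; case: v => -[] [] //=; case: ifP => // _;
      rewrite ?Hword_in ?Hword_out0.
  by rewrite E; case: (v == G) => //; rewrite puz0.
have -> : puz (y :: ys) (h :: hs) (Hright x (y :: ys)) (l :: la)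
  = corner h l (fun a => strip y ys (fun ka v =>
      if v == G then puz ys hs (Hright (x \o lift ord0) ys) ka else 0) a la).
  by apply: eq_corner => a; apply: eq_strip => ka v _.
case/orP: ho => /eqP->.
  rewrite /= [X in _ * X]Hword_out0 // mulr0.
  by case/orP: lo => /eqP-> //=; rewrite strip_no_green.
(* The single green unit leaves at the end of the strip, so [ka] has none and is again a left word,
   to which the induction hypothesis applies. *)
have S1 (a : state) : a.2 -> strip y ys (fun ka v =>
      if v == G then puz ys hs (Hright (x \o lift ord0) ys) ka else 0) a la
  = Hword (x \o lift ord0) ys [seq s == G | s <- hs]
     * Hleft x (y :: ys) ((a.1, false) :: la).
  move=> ag; rewrite -(@strip_Hleft k x y [::] ys [::]) // -stripZ.
  apply: (eq_strip_flow (c := snd)); first by right.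
  move=> ka v ska; case: eqP => [->|_]; last by rewrite mulr0.
  rewrite ag (left_green lao) /= => fk; rewrite -IH //; first by rewrite mulrC.
  have : flow snd ka == 0%N by apply/eqP; lia.
  by rewrite flow_green_left; apply: sub_all => -[[] []].
rewrite /= Hword_in //.
by case/orP: lo => /eqP-> /=; rewrite S1 // mulrC.
Qed.

(** At the first [a] with I a <> a one has I a > a, and I a - 1 is not a value of I. Exchanging the
    variables at the places I a - 1 and I a lowers I a by one without changing x; the induction is
    on the sum of the values of I. *)
Lemma product_rule_mono k (x : 'I_k -> F) ys (I : 'I_k -> nat) : generic ys ->
  (forall a b : 'I_k, (a < b)%N -> (I a < I b)%N) ->
  (forall a, (I a < size ys)%N) -> (forall a, x a = nth 0 ys (I a)) ->
  product_rule x ys.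
Proof.
have [m] := ubnP (\sum_a I a); elim: m => // m IH in ys I *.
rewrite ltnS => Im ge mono Is xI.
case: (pickP (fun a => I a != a)) => [a0 Ia0|Ia].
  case: (@arg_minnP _ a0 (fun a : 'I_k => I a != a) (fun a => a : nat) Ia0) =>
    a Ia amin.
  have small (b : 'I_k) : (b < a)%N -> I b = b.
    move=> ba; apply/eqP; apply: contraLR ba => /amin; by rewrite -leqNgt.
  have aI : (a < I a)%N.
    rewrite ltn_neqAle eq_sym Ia /=; case: a {Ia amin} small => -[|c] ca small
      //=.
    have cb : (c < k)%N := ltnW ca.
    by have := mono (Ordinal cb) (Ordinal ca) (ltnSn c);
      rewrite (small (Ordinal cb)) /=.
  pose i := (I a).-1.
  have Ia1 : I a = i.+1 by rewrite /i prednK // (leq_ltn_trans _ aI).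
  have := Is a; rewrite Ia1 => iS.
  pose ps := take i ys; pose y1 := nth 0 ys i; pose y2 := nth 0 ys i.+1.
  pose qs := drop i.+2 ys.
  have sps : size ps = i by rewrite size_takel // ltnW // ltnW.
  have ey : ys = ps ++ y1 :: y2 :: qs.
    by rewrite /y1 /y2 /ps -!drop_nth ?cat_take_drop // ltnW.
  pose I' b := if b == a then i else I b.
  have Ib b : b != a -> I b <> i /\ I b <> i.+1.
    move=> ba; have : (b < a)%N || (a < b)%N by rewrite -neq_ltn.
    case/orP=> h; first by rewrite small //; have := mono _ _ h;
      rewrite small //; lia.
    by have := mono _ _ h; lia.
  rewrite ey; apply: product_rule_swap.
    by rewrite -(generic_perm (perm_swap2 _ _ _ _)) -ey.
  apply: (IH _ I').
  - apply: leq_trans Im; rewrite (bigD1 a) //= [X in (_ < X)%N](bigD1 a) //=.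
    rewrite /I' eqxx Ia1 addSn ltnS leq_add2l.
    by apply: leq_sum => b ba; rewrite (negbTE ba).
  - by rewrite -(generic_perm (perm_swap2 _ _ _ _)) -ey.
  - move=> b c bc; have := mono _ _ bc; rewrite /I'.
    case: eqVneq => [->|ba]; case: eqVneq => [->|ca]; rewrite ?Ia1; try lia.
    by have := Ib _ ba; lia.
  - have s : size (ps ++ y2 :: y1 :: qs) = size ys by rewrite ey !size_cat.
    by move=> b; rewrite s /I'; case: eqP => // _; lia.
  move=> b; rewrite xI /I'; case: eqVneq => [->|/Ib[b1 b2]].
    by rewrite -sps nth_cat ltnn subnn /= Ia1.
  rewrite [in LHS]ey !nth_cat sps; case: ltnP => // ib.
  by case E: (I b - i)%N => [|[|c]] //; lia.
have {}Ia a : I a = a by apply/eqP; move: (Ia a) => /negbT; rewrite negbK.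
apply: product_rule_first => //; last by move=> a; rewrite xI Ia.
have [->//|k0] := posnP k.
have kk : (k.-1 < k)%N by rewrite prednK.
by have := Is (Ordinal kk); rewrite Ia /= prednK.
Qed.

End Words.

(** * Puzzle sums as products of strip operators *)

Section Tabulation.

Definition tab (T : Type) n (f : 'I_n -> T) : seq T := [seq f i | i <- enum
  'I_n].

Lemma size_tab T n (f : 'I_n -> T) : size (tab f) = n.
Proof. by rewrite size_map size_enum_ord. Qed.

Lemma nth_tab T n (f : 'I_n -> T) d (i : 'I_n) : nth d (tab f) i = f i.
Proof. by rewrite (nth_map i) ?size_enum_ord ?nth_ord_enum. Qed.

Lemma eq_tab T n (f g : 'I_n -> T) : f =1 g -> tab f = tab g.
Proof. by move=> e; apply: eq_map. Qed.

Lemma tabS T n (f : 'I_n.+1 -> T) : tab f = f ord0 :: tab (f \o lift ord0).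
Proof. by rewrite /tab enum_ordSl /= -map_comp. Qed.

Lemma map_tab T U n (f : 'I_n -> T) (g : T -> U) :
  [seq g a | a <- tab f] = tab (g \o f).
Proof. by rewrite /tab -map_comp. Qed.

Lemma rev_tab T n (f : 'I_n -> T) : rev (tab f) = tab (f \o @rev_ord n).
Proof.
case: n f => [|n] f; first by rewrite /tab enum_ord0.
apply: (@eq_from_nth _ (f ord0)); first by rewrite size_rev !size_tab.
move=> i; rewrite size_rev size_tab => lt.
rewrite nth_rev ?size_tab // (nth_tab _ _ (Ordinal lt)) /=.
by rewrite -(nth_tab f (f ord0) (rev_ord (Ordinal lt))).
Qed.

Lemma tab_inj T n (f g : 'I_n -> T) : tab f = tab g -> f =1 g.
Proof.
by move=> e i; rewrite -(nth_tab f (f i) i) e nth_tab.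
Qed.

Lemma tab_nth (T : eqType) n (d : T) s : size s = n ->
  s = tab (fun i : 'I_n => nth d s i).
Proof.
move=> sn; apply: (@eq_from_nth _ d); rewrite ?size_tab // => i;
  rewrite sn => lt.
by rewrite (nth_tab _ _ (Ordinal lt)).
Qed.

End Tabulation.

Section FiniteSplittings.

Definition sum_fun (A B C : Type) (f1 : B -> A) (f2 : C -> A) (s : B + C) : A :=
  match s with inl b => f1 b | inr c => f2 c end.

Lemma sum_fun_bij (A B C : finType) (f1 : B -> A) (f2 : C -> A) :
  injective f1 -> injective f2 -> (forall b c, f1 b <> f2 c) ->
  (forall a, (exists b, f1 b = a) \/ (exists c, f2 c = a)) ->
  bijective (sum_fun f1 f2).
Proof.
move=> i1 i2 d s.
have ex a : exists t, sum_fun f1 f2 t == a.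
  by case: (s a) => -[b <-]; [exists (inl b) | exists (inr b)]; rewrite /= eqxx.
exists (fun a => xchoose (ex a)) => [t|a]; last exact/eqP/(xchooseP (ex a)).
have := xchooseP (ex (sum_fun f1 f2 t)); move: (xchoose _) => u /eqP.
case: u t => [b|c] [b'|c'] /=; first by move/i1->.
- by move/d.
- by move=> e; case: (d b' c).
- by move/i2->.
Qed.

Variables (A B C : finType) (f1 : B -> A) (f2 : C -> A).
Hypothesis fbij : bijective (sum_fun f1 f2).

Lemma prod_split (F : fieldType) (Q : pred A) (f : A -> F) :
  \prod_(a | Q a) f a
  = (\prod_(b | Q (f1 b)) f (f1 b)) * \prod_(c | Q (f2 c)) f (f2 c).
Proof.
rewrite (reindex (sum_fun f1 f2)) /=; last exact: onW_bij.
by rewrite big_sumType.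
Qed.

Lemma sum_ffun_split (T : finType) (V : nmodType)
    (Psi : {ffun B -> T} -> {ffun C -> T} -> V) :
  \sum_(D : {ffun A -> T}) Psi [ffun b => D (f1 b)] [ffun c => D (f2 c)]
  = \sum_d \sum_e Psi d e.
Proof.
have [g fK gK] := fbij.
rewrite pair_bigA /=.
rewrite [RHS](reindex (fun D : {ffun A -> T} =>
  ([ffun b => D (f1 b)], [ffun c => D (f2 c)]))) //=.
exists (fun p : {ffun B -> T} * {ffun C -> T} =>
  [ffun a => match g a return T with inl b => p.1 b | inr c => p.2 c end]).
  move=> D _; apply/ffunP => a; rewrite ffunE.
  by rewrite -{2}(gK a); case: (g a) => b; rewrite !ffunE.
case=> d e _; congr (_, _); apply/ffunP => b; rewrite !ffunE.
  by rewrite -[f1 b]/(sum_fun f1 f2 (inl b)) fK.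
by rewrite -[f2 b]/(sum_fun f1 f2 (inr b)) fK.
Qed.

End FiniteSplittings.

Lemma sum_ffun0 (T : finType) (V : nmodType) (Psi : {ffun 'I_0 -> T} -> V) u :
  \sum_d Psi d = Psi u.
Proof.
rewrite (big_pred1 u) // => d; apply/esym/eqP/ffunP; by case.
Qed.

Lemma forall_ordS n (Q : pred 'I_n.+1) :
  [forall i, Q i] = Q ord0 && [forall i, Q (lift ord0 i)].
Proof.
apply/forallP/andP => [q|[q0 /forallP q] i]; first by split=> //; apply/forallP.
by case: (unliftP ord0 i) => [j|] ->.
Qed.

Lemma sum_ffunS n (T : finType) (V : nmodType)
    (Psi : T -> {ffun 'I_n -> T} -> V) :
  \sum_(d : {ffun 'I_n.+1 -> T}) Psi (d ord0) [ffun i => d (lift ord0 i)]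
  = \sum_t \sum_d Psi t d.
Proof.
rewrite pair_bigA /=.
rewrite [RHS](reindex (fun D : {ffun 'I_n.+1 -> T} =>
  (D ord0, [ffun i => D (lift ord0 i)]))) //=.
exists (fun p : T * {ffun 'I_n -> T} =>
  [ffun a => if unlift ord0 a is Some b then p.2 b else p.1]).
  move=> D _; apply/ffunP => a; rewrite ffunE.
  by case: unliftP => [j|] -> //=; rewrite ffunE.
case=> t d _; congr (_, _); first by rewrite ffunE unlift_none.
by apply/ffunP => b; rewrite !ffunE liftK.
Qed.

Section StripSums.

Variable F : fieldType.

Lemma corner_sum h l (f : state -> F) :
  corner h l f
  = \sum_(t in down_tiles | (edge_b t == l) && (edge_h t == h)) f (edge_a t).
Proof.
rewrite big_mkcondr -big_uniq //= !big_cons big_nil.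
by case: h l => [[] []] [[] []]; rewrite /= ?addr0 ?add0r.
Qed.

Lemma loz_sum w (X : state -> state -> F) a l :
  loz w X a l
  = \sum_(s in up_tiles | edge_a s == a)
      \sum_(t in down_tiles | (edge_b t == l) && (edge_h t == edge_h s))
        lozenge_weight w s t * X (edge_b s) (edge_a t).
Proof.
rewrite big_mkcondr -big_uniq //= !big_cons big_nil.
under [LHS]eq_loz => k a' do rewrite -[X k a']mul1r.
have E s : \sum_(t in down_tiles | (edge_b t == l) && (edge_h t == edge_h s))
        lozenge_weight w s t * X (edge_b s) (edge_a t)
   = \sum_(t <- down_tiles) if (edge_b t == l) && (edge_h t == edge_h s) then
        lozenge_weight w s t * X (edge_b s) (edge_a t) else 0.
  by rewrite big_mkcondr -big_uniq.
rewrite !E !big_cons !big_nil.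
by case: a l {E} => [[] []] [[] []]; rewrite /= ?addr0 ?add0r //
  /lozenge_weight !eqE /= ?mul1r; ring.
Qed.

(** The tiles of the first strip from the top: [u r] shares its a-edge with [d r] and its h-edge
    with the next down-pointing tile. *)
Definition strip_ok n (d : {ffun 'I_n.+1 -> tile}) (u : {ffun 'I_n -> tile}) :=
  [&& [forall r, d r \in down_tiles], [forall r, u r \in up_tiles],
      [forall r : 'I_n, edge_a (u r) == edge_a (d (widen_ord (leqnSn n) r))] &
      [forall r, edge_h (u r) == edge_h (d (lift ord0 r))]].

(** The arbitrary weight [c] of the top tile is needed for the induction: after the first lozenge is
    removed, its weight depends on the tile that has become the top one. It also serves to impose
    the letter of the top side. *)
Lemma strip_sum n y1 (y : 'I_n -> F) (c : tile -> F) (f : state -> F) l la ka :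
  size la = n -> size ka = n ->
  \sum_(d : {ffun 'I_n.+1 -> tile}) \sum_(u : {ffun 'I_n -> tile})
    (if [&& strip_ok d u, tab (edge_b \o d) == l :: la &
            tab (edge_b \o u) == ka] then
       c (d ord0) * \prod_r lozenge_weight (y1 / y r) (u r) (d (lift ord0 r))
       * f (edge_a (d ord_max))
     else 0)
  = \sum_(t in down_tiles | edge_b t == l)
      c t * strip y1 [seq y i | i <- enum 'I_n]
              (fun ka' v => if ka' == ka then f v else 0) (edge_a t) la.
Proof.
elim: n y c l la ka => [|n IH] y c l [|l2 la] [|k ka] //.
  move=> _ _.
  have e0 (g : 'I_0 -> state) : tab g = [::] by rewrite /tab enum_ord0.
  under eq_bigr => d _ do rewrite (sum_ffun0 _ [ffun => tE]) big_ord0 mulr1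
    tabS !e0.
  pose Psi (t : tile) (d : {ffun 'I_0 -> tile}) :=
    if (t \in down_tiles) && (edge_b t == l) then c t * f (edge_a t) else 0.
  transitivity (\sum_(d : {ffun 'I_1 -> tile}) Psi (d ord0) [ffun i => d (lift
    ord0 i)]).
    apply: eq_bigr => d _; rewrite /Psi (ord1 ord_max) eqseq_cons !eqxx !andbT.
    congr (if _ && _ then _ else _).
    apply/and4P/idP => [[/forallP/(_ ord0)//]|dd]; split; apply/forallP => r.
    - by rewrite ord1.
    - by case: r.
    - by case: r.
    - by case: r.
  rewrite (sum_ffunS Psi) [RHS]big_mkcond.
  apply: eq_bigr => t _; rewrite (sum_ffun0 _ [ffun => tE]) /Psi enum_ord0 /=.
  by rewrite inE.
case=> sla [ska].
(* For a fixed up-pointing tile [s], this is the weight given to the next down-pointing tile in the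
   induction hypothesis, gluing condition included. *)
pose W (s t : tile) := if edge_h t == edge_h s
  then lozenge_weight (y1 / y ord0) s t else 0.
pose Z (s : tile) := \sum_(t' in down_tiles | edge_b t' == l2)
  W s t' * strip y1 [seq y (lift ord0 i) | i <- enum 'I_n]
    (fun ka' v => if ka' == ka then f v else 0) (edge_a t') la.
pose In (d : {ffun 'I_n.+1 -> tile}) (u : {ffun 'I_n -> tile}) (s : tile) : F :=
  if [&& strip_ok d u, tab (edge_b \o d) == l2 :: la & tab (edge_b \o u) == ka]
  then W s (d ord0) * \prod_r lozenge_weight (y1 / y (lift ord0 r)) (u r) (d
    (lift ord0 r))
       * f (edge_a (d ord_max)) else 0.
pose Psi (t : tile) (d : {ffun 'I_n.+1 -> tile}) (s : tile) (u : {ffun 'I_n ->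
  tile}) : F :=
  if [&& t \in down_tiles, edge_b t == l, s \in up_tiles, edge_a s == edge_a t &
         edge_b s == k] then c t * In d u s else 0.
transitivity (\sum_(d : {ffun 'I_n.+2 -> tile}) \sum_(u : {ffun 'I_n.+1 ->
  tile})
  Psi (d ord0) [ffun i => d (lift ord0 i)] (u ord0) [ffun i => u (lift ord0
    i)]).
  apply: eq_bigr => d _; apply: eq_bigr => u _.
  rewrite /Psi /In.
  set d' := [ffun i => d _]; set u' := [ffun i => u _].
  have Ed : tab (edge_b \o d') = tab ((edge_b \o d) \o lift ord0).
    by apply: eq_tab => i; rewrite /= ffunE.
  have Eu : tab (edge_b \o u') = tab ((edge_b \o u) \o lift ord0).
    by apply: eq_tab => i; rewrite /= ffunE.
  rewrite tabS [tab (edge_b \o u)]tabS !eqseq_cons Ed Eu /= /W ffunE.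
  have -> : strip_ok d u = [&& d ord0 \in down_tiles, u ord0 \in up_tiles,
     edge_a (u ord0) == edge_a (d ord0), edge_h (d (lift ord0 ord0)) == edge_h
       (u ord0)
     & strip_ok d' u'].
    rewrite /strip_ok forall_ordS [X in [&& _, X & _]]forall_ordS.
    rewrite [X in [&& _, _, X & _]]forall_ordS [X in [&& _, _, _ &
      X]]forall_ordS.
    rewrite (_ : widen_ord _ ord0 = ord0); last exact: val_inj.
    rewrite (eq_sym (edge_h (u ord0))).
    have -> : [forall i, d (lift ord0 i) \in down_tiles] = [forall i, d' i \in
      down_tiles].
      by apply: eq_forallb => i; rewrite ffunE.
    have -> : [forall i, u (lift ord0 i) \in up_tiles] = [forall i, u' i \in
      up_tiles].
      by apply: eq_forallb => i; rewrite ffunE.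
    have -> : [forall i : 'I_n, edge_a (u (lift ord0 i)) ==
        edge_a (d (widen_ord (leqnSn n.+1) (lift ord0 i)))]
     = [forall i, edge_a (u' i) == edge_a (d' (widen_ord (leqnSn n) i))].
      apply: eq_forallb => i; rewrite !ffunE.
      by rewrite (_ : widen_ord _ (lift _ _) = lift ord0 (widen_ord (leqnSn n)
        i)) //; apply: val_inj.
    have -> : [forall i, edge_h (u (lift ord0 i)) == edge_h (d (lift ord0 (lift
      ord0 i)))]
      = [forall i, edge_h (u' i) == edge_h (d' (lift ord0 i))].
      by apply: eq_forallb => i; rewrite !ffunE.
    have sh (a a' b b' e e' g g' : bool) : [&& a && a', b && b', e && e' & g &&
      g']
      = [&& a, b, e, g & [&& a', b', e' & g']].
      by case: a; case: b; case: e; case: g; rewrite ?andbF.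
    exact: sh.
  rewrite big_ord_recl !ffunE.
  have -> : \prod_i lozenge_weight (y1 / y (lift ord0 i)) (u (lift ord0 i)) (d
    (lift ord0 (lift ord0 i)))
   = \prod_i lozenge_weight (y1 / y (lift ord0 i)) (u' i) (d' (lift ord0 i)).
    by apply: eq_bigr => i _; rewrite !ffunE.
  rewrite (_ : lift ord0 ord_max = ord_max); last exact: val_inj.
  case: (d ord0 \in _) => //=; case: (edge_b (d ord0) == l) => //=;
    rewrite ?andbF //=.
  case: (u ord0 \in _) => //=; case: (edge_a (u ord0) == _) => //=;
    rewrite ?andbF //=.
  case: (edge_b (u ord0) == k) => //=; rewrite ?andbF //=.
  case: (edge_h _ == _); case: (strip_ok _ _) => //=; rewrite ?mulr0 //.
    by case: ifP; rewrite ?mulr0 // !mulrA.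
  by case: ifP; rewrite ?mul0r ?mulr0.
rewrite (sum_ffunS (fun t d => \sum_(u : {ffun 'I_n.+1 -> tile})
  Psi t d (u ord0) [ffun i => u (lift ord0 i)])).
rewrite [RHS]big_mkcond; apply: eq_bigr => t _.
under eq_bigr => d _ do rewrite (sum_ffunS (Psi t d)).
rewrite exchange_big /=.
have EZ s : \sum_d \sum_u In d u s = Z s.
  by rewrite /In IH // -map_comp.
have -> : \sum_s \sum_d \sum_u Psi t d s u =
  \sum_s if [&& t \in down_tiles, edge_b t == l, s \in up_tiles, edge_a s ==
    edge_a t &
         edge_b s == k] then c t * Z s else 0.
  apply: eq_bigr => s _; rewrite /Psi; case: ifP => _; last first.
    by rewrite big1 // => d _; rewrite big1.
  rewrite -EZ big_distrr; apply: eq_bigr => d _; by rewrite big_distrr.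
case: (t \in down_tiles) => /=; last by rewrite big1.
case: (edge_b t == l) => /=; last by rewrite big1.
rewrite enum_ordSl /= loz_sum -big_mkcond /= big_distrr /=.
rewrite [RHS]big_mkcond [LHS]big_mkcond; apply: eq_bigr => s _.
case: (s \in up_tiles) => //=; case: (edge_a s == _) => //=.
rewrite -map_comp; case: (eqVneq (edge_b s) k) => [ek|nk]; last first.
  rewrite big1 ?mulr0 // => t' _.
  rewrite -[RHS](mulr0 (lozenge_weight (y1 / y ord0) s t')); congr (_ * _).
  rewrite -[RHS](strip0 y1 [seq (y \o lift ord0) i | i <- enum 'I_n] (edge_a
    t') la).
  by apply: eq_strip => ka' v _; rewrite eqseq_cons (negbTE nk).
congr (_ * _); rewrite /Z [LHS]big_mkcond [RHS]big_mkcond;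
  apply: eq_bigr => t' _.
rewrite /W; case: (t' \in _) => //=; case: (edge_b t' == l2) => //=.
case: (edge_h t' == _); rewrite ?mul0r //; congr (_ * _).
by apply: eq_strip => ka' v _; rewrite eqseq_cons ek eqxx.
Qed.

End StripSums.

Section PuzzleSums.

Variable F : fieldType.

Section Positions.

Variable n : nat.

Lemma ord_pos (r : 'I_n) : (0 < n)%N.
Proof. exact: leq_ltn_trans (leq0n r) (ltn_ord r). Qed.

Lemma lpos_subproof (r : 'I_n) : (r + Ordinal (ord_pos r) < n)%N.
Proof. by rewrite addn0. Qed.

Definition lpos (r : 'I_n) : down_pos n :=
  exist _ (r, Ordinal (ord_pos r)) (lpos_subproof r).

Definition tpos (c : 'I_n) : down_pos n :=
  exist _ (Ordinal (ord_pos c), c) (ltn_ord c).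

Lemma rpos_subproof (i : 'I_n) : (rev_ord i + i < n)%N.
Proof. by have := ltn_ord i; rewrite /=; lia. Qed.

(** Indexed by columns, hence from the bottom to the top. *)
Definition rpos (i : 'I_n) : down_pos n :=
  exist _ (rev_ord i, i) (rpos_subproof i).

Lemma down_pos_inj (v v' : down_pos n) :
  drow v = drow v' :> nat -> dcol v = dcol v' :> nat -> v = v'.
Proof.
case: v v' => [[r c] p] [[r' c'] p']; rewrite /drow /dcol /= => er ec.
by apply: val_inj; congr (_, _); apply: val_inj.
Qed.

Lemma up_pos_inj (v v' : up_pos n) :
  urow v = urow v' :> nat -> ucol v = ucol v' :> nat -> v = v'.
Proof.
case: v v' => [[r c] p] [[r' c'] p']; rewrite /urow /ucol /= => er ec.
by apply: val_inj; congr (_, _); apply: val_inj.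
Qed.

Definition left_word (P : tiling n) := tab (fun r => edge_b (P.1 (lpos r))).
Definition top_word (P : tiling n) := tab (fun c => edge_h (P.1 (tpos c))).
Definition right_word (P : tiling n) := tab (fun i => edge_a (P.1 (rpos i))).

Lemma is_puzzleP (P : tiling n) :
  reflect [/\ forall v, P.1 v \in down_tiles, forall u, P.2 u \in up_tiles,
    forall u v, at_left u v -> edge_a (P.2 u) = edge_a (P.1 v),
    forall u v, at_right u v -> edge_b (P.2 u) = edge_b (P.1 v) &
    forall u v, below u v -> edge_h (P.2 u) = edge_h (P.1 v)] (is_puzzle P).
Proof.
apply: (iffP and3P) => [[/forallP H1 /forallP H2 /forallP H3]|[H1 H2 Ha Hb Hh]].
  by split=> // u v; have /forallP/(_ v)/and3P[/implyP a /implyP b /implyP c]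
    := H3 u;
    move=> h; apply/eqP; auto.
split; try exact/forallP.
apply/forallP => u; apply/forallP => v; apply/and3P.
by split; apply/implyP => h; apply/eqP; auto.
Qed.

End Positions.

(** * Cutting off the first column of a triangle *)

Section FirstColumn.

Variable n : nat.

Lemma dshift_subproof (v : down_pos n) :
  (widen_ord (leqnSn n) (drow v) + lift ord0 (dcol v) < n.+1)%N.
Proof. by case: v => [[r c] p]; rewrite /= /bump /= add1n addnS ltnS. Qed.

Definition dshift (v : down_pos n) : down_pos n.+1 :=
  exist _ (widen_ord (leqnSn n) (drow v), lift ord0 (dcol v)) (dshift_subproof
    v).

Lemma ushift_subproof (u : up_pos n) :
  (widen_ord (leqnSn n) (urow u) + (lift ord0 (ucol u)).+1 < n.+1)%N.
Proof. by case: u => [[r c] p]; rewrite /= /bump /= add1n addnS ltnS. Qed.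

Definition ushift (u : up_pos n) : up_pos n.+1 :=
  exist _ (widen_ord (leqnSn n) (urow u), lift ord0 (ucol u)) (ushift_subproof
    u).

Lemma ufirst_subproof (r : 'I_n) :
  (widen_ord (leqnSn n) r + (ord0 : 'I_n.+1).+1 < n.+1)%N.
Proof. by rewrite /= addn1 ltnS. Qed.

Definition ufirst (r : 'I_n) : up_pos n.+1 :=
  exist _ (widen_ord (leqnSn n) r, ord0) (ufirst_subproof r).

Lemma down_bij : bijective (sum_fun (@lpos n.+1) dshift).
Proof.
apply: sum_fun_bij => [r s /(congr1 (@drow _)) //|v v' e|r v /(congr1 (@dcol
  _)) //|v].
  apply: down_pos_inj; first by have := congr1 (fun v => drow v : nat) e.
  by have := congr1 (fun v => dcol v : nat) e;
    rewrite /= /bump /= !add1n => -[].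
case: (unliftP ord0 (dcol v)) => [c ec|ec]; [right|left].
  have lt : (drow v < n)%N.
    by have := svalP v; rewrite -/(drow v) -/(dcol v) ec /= /bump /=; lia.
  have lt' : (Ordinal lt + c < n)%N.
    by have := svalP v; rewrite -/(drow v) -/(dcol v) ec /= /bump /=; lia.
  by exists (exist _ (Ordinal lt, c) lt'); apply: down_pos_inj; rewrite //= ec.
by exists (drow v); apply: down_pos_inj; rewrite //= ec.
Qed.

Lemma up_bij : bijective (sum_fun ufirst ushift).
Proof.
apply: sum_fun_bij => [r s e|v v' e|r v /(congr1 (@ucol _)) //|v].
- by apply: val_inj; have := congr1 (fun v => urow v : nat) e.
- apply: up_pos_inj; first by have := congr1 (fun v => urow v : nat) e.
  by have := congr1 (fun v => ucol v : nat) e;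
    rewrite /= /bump /= !add1n => -[].
case: (unliftP ord0 (ucol v)) => [c ec|ec]; [right|left].
  have lt : (urow v < n)%N.
    by have := svalP v; rewrite -/(urow v) -/(ucol v) ec /= /bump /=; lia.
  have lt' : (Ordinal lt + c.+1 < n)%N.
    by have := svalP v; rewrite -/(urow v) -/(ucol v) ec /= /bump /=; lia.
  by exists (exist _ (Ordinal lt, c) lt'); apply: up_pos_inj; rewrite //= ec.
have lt : (urow v < n)%N.
  by have := svalP v; rewrite -/(urow v) -/(ucol v) ec /=; lia.
by exists (Ordinal lt); apply: up_pos_inj; rewrite //= ec.
Qed.

Variable P : tiling n.+1.

Definition column_down : {ffun 'I_n.+1 -> tile} := [ffun r => P.1 (lpos r)].
Definition column_up : {ffun 'I_n -> tile} := [ffun r => P.2 (ufirst r)].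
Definition tiling_rest : tiling n :=
  ([ffun v => P.1 (dshift v)], [ffun u => P.2 (ushift u)]).

Lemma is_puzzle_column : is_puzzle P =
  [&& strip_ok column_down column_up,
      left_word tiling_rest == tab (edge_b \o column_up) & is_puzzle
        tiling_rest].
Proof.
apply/is_puzzleP/and3P => [[H1 H2 Ha Hb Hh]|[]].
  split.
  - apply/and4P; split; apply/forallP => r; rewrite !ffunE //; apply/eqP.
      by apply: Ha; rewrite /at_left /= !eqxx.
    by apply: Hh; rewrite /below /= /bump /= !eqxx.
  - apply/eqP; apply: eq_tab => r; rewrite /= !ffunE; apply/esym/Hb.
    by rewrite /at_right /= !eqxx.
  - apply/is_puzzleP; split=> [v|u|u v|u v|u v] /=; rewrite !ffunE // => h.
    + by apply: Ha; move: h; rewrite /at_left /= /bump /= eqSS.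
    + by apply: Hb; move: h; rewrite /at_right /= /bump /= eqSS.
    + by apply: Hh; move: h; rewrite /below /= /bump /= eqSS.
case/and4P=> /forallP C1 /forallP C2 /forallP Ca /forallP Ch /eqP/tab_inj Cb.
case/is_puzzleP=> H1 H2 Ha Hb Hh.
have casev (Q : down_pos n.+1 -> Prop) : (forall r, Q (lpos r)) ->
    (forall v, Q (dshift v)) -> forall v, Q v.
  move=> q1 q2 v; have [g _ gK] := down_bij.
  by rewrite -(gK v); case: (g v).
have caseu (Q : up_pos n.+1 -> Prop) : (forall r, Q (ufirst r)) ->
    (forall v, Q (ushift v)) -> forall v, Q v.
  move=> q1 q2 v; have [g _ gK] := up_bij.
  by rewrite -(gK v); case: (g v).
split.
- by apply: casev => [r|v]; [have := C1 r | have := H1 v]; rewrite ffunE.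
- by apply: caseu => [r|v]; [have := C2 r | have := H2 v]; rewrite ffunE.
- apply: caseu => [r|u]; apply: casev => [s|v]; rewrite /at_left /= ?andbF //.
    case/andP=> /eqP e _; have /eqP := Ca r; rewrite !ffunE => ->.
    by congr (edge_a (P.1 (lpos _))); apply: val_inj.
  by rewrite /bump /= eqSS => h; have := Ha u v h; rewrite !ffunE.
- apply: caseu => [r|u]; apply: casev => [s|v]; rewrite /at_right /= ?andbF //.
    rewrite /bump /= add1n eqSS => /andP[/eqP e /eqP e'].
    have := Cb r; rewrite /= !ffunE => <-.
    by congr (edge_b (P.1 (dshift _))); apply: down_pos_inj.
  by rewrite /bump /= eqSS => h; have := Hb u v h; rewrite !ffunE.
- apply: caseu => [r|u]; apply: casev => [s|v]; rewrite /below /= ?andbF //.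
    case/andP=> /eqP e _; have /eqP := Ch r; rewrite !ffunE => ->.
    by congr (edge_h (P.1 (lpos _))); apply: val_inj.
  by rewrite /bump /= eqSS => h; have := Hh u v h; rewrite !ffunE.
Qed.

Lemma puzzle_weight_column (y : 'I_n.+1 -> F) : puzzle_weight y P =
  \prod_r lozenge_weight (y ord0 / y (lift ord0 r)) (column_up r)
            (column_down (lift ord0 r))
  * puzzle_weight (y \o lift ord0) tiling_rest.
Proof.
rewrite /puzzle_weight (prod_split up_bij) /=; congr (_ * _).
  apply: eq_bigr => r _; rewrite (prod_split down_bij) /=.
  rewrite (big_pred1 (lift ord0 r)) => [|s]; last first.
    by rewrite /below /= andbT -val_eqE.
  rewrite [X in _ * X]big_pred0 => [|v]; last by rewrite /below /= andbF.
  rewrite mulr1 !ffunE; congr (lozenge_weight (y _ / y _) _ _);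
    apply: val_inj => //=.
  by rewrite addn1.
apply: eq_bigr => u _; rewrite (prod_split down_bij) /=.
rewrite big_pred0 ?mul1r => [|v]; last by rewrite /below /= andbF.
apply: eq_big => [v|v _]; first by rewrite /below /= /bump /= eqSS.
rewrite !ffunE; congr (lozenge_weight (y _ / y _) _ _); apply: val_inj => //=.
by rewrite /bump /= !add1n addnS.
Qed.

Lemma left_word_column : left_word P = tab (edge_b \o column_down).
Proof. by apply: eq_tab => r; rewrite /= ffunE. Qed.

Lemma top_word_column :
  top_word P = edge_h (column_down ord0) :: top_word tiling_rest.
Proof.
rewrite /top_word tabS ffunE; congr (edge_h (P.1 _) :: _).
  exact: down_pos_inj.
apply: eq_tab => c; rewrite /= ffunE; congr (edge_h (P.1 _)).
exact: down_pos_inj.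
Qed.

Lemma right_word_column :
  right_word P = edge_a (column_down ord_max) :: right_word tiling_rest.
Proof.
rewrite /right_word tabS ffunE; congr (edge_a (P.1 _) :: _).
  by apply: down_pos_inj; rewrite //= subn1.
apply: eq_tab => c; rewrite /= ffunE; congr (edge_a (P.1 _)).
by apply: down_pos_inj; rewrite //= /bump /= add1n subSS.
Qed.

End FirstColumn.

(** The right side is left free and weighted by [Xi], as in [puz]. *)
Definition puzzle_term n (y : 'I_n -> F) hs (Xi : seq state -> F) la P : F :=
  if [&& is_puzzle P, top_word P == hs & left_word P == la]
  then puzzle_weight y P * Xi (right_word P) else 0.

Lemma strip_bigsum (I : Type) (r : seq I) y1 ys
    (Phi : I -> seq state -> state -> F) a la :
  strip y1 ys (fun ka v => \sum_(i <- r) Phi i ka v) a la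
  = \sum_(i <- r) strip y1 ys (Phi i) a la.
Proof.
elim: r => [|i r IH].
  rewrite big_nil -[RHS](strip0 y1 ys a la).
  by apply: eq_strip => ka v _; rewrite big_nil.
rewrite big_cons -IH -stripD.
by apply: eq_strip => ka v _; rewrite big_cons.
Qed.

Lemma puzzle_sum_puz n (y : 'I_n -> F) hs (Xi : seq state -> F) la :
  size hs = n -> size la = n ->
  \sum_P puzzle_term y hs Xi la P = puz [seq y i | i <- enum 'I_n] hs Xi la.
Proof.
elim: n y hs Xi la => [|n IH] y [|h hs] Xi [|l la] //.
  move=> _ _; rewrite enum_ord0 /=.
  rewrite (big_pred1 ([ffun=> tE], [ffun=> tE])); last first.
    move=> [D U]; apply/esym/eqP; congr (_, _); apply/ffunP => -[[r c] p];
      by have := ltn_ord r.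
  have e0 (g : 'I_0 -> state) : tab g = [::] by rewrite /tab enum_ord0.
  rewrite /puzzle_term /top_word /left_word /right_word !e0 !eqxx.
  have -> : is_puzzle (n := 0) ([ffun=> tE], [ffun=> tE]).
    by apply/is_puzzleP; split=> [[[r]]|[[r]]|[[r]]|[[r]]|[[r]]];
      have := ltn_ord r.
  by rewrite /puzzle_weight big_pred0 ?mul1r // => -[[r]]; have := ltn_ord r.
case=> sh [sl].
(* All that involves the first column, once the rest is fixed. The top letter [h] is imposed by a
   factor 0 or 1, which is the weight [c] of [strip_sum]. *)
pose W (d : {ffun 'I_n.+1 -> tile}) (u : {ffun 'I_n -> tile}) (P : tiling n) :
  F :=
  if [&& strip_ok d u, tab (edge_b \o d) == l :: la &
      tab (edge_b \o u) == left_word P] then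
    (edge_h (d ord0) == h)%:R
    * \prod_r lozenge_weight (y ord0 / y (lift ord0 r)) (u r) (d (lift ord0 r))
    * Xi (edge_a (d ord_max) :: right_word P) else 0.
pose Psi d (D : {ffun down_pos n -> tile}) u (U : {ffun up_pos n -> tile}) : F
  :=
  if is_puzzle (D, U) && (top_word (D, U) == hs) then
    puzzle_weight (y \o lift ord0) (D, U) * W d u (D, U) else 0.
transitivity (\sum_(D : {ffun down_pos n.+1 -> tile})
   \sum_(U : {ffun up_pos n.+1 -> tile})
   Psi [ffun r => D (lpos r)] [ffun v => D (dshift v)]
       [ffun r => U (ufirst r)] [ffun u => U (ushift u)]).
  rewrite pair_bigA; apply: eq_bigr => -[D U] _.
  rewrite /puzzle_term is_puzzle_column top_word_column right_word_column.
  rewrite left_word_column puzzle_weight_column /Psi /W /= eqseq_cons.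
  rewrite -/(column_down (D, U)) -/(column_up (D, U)) -/(tiling_rest (D, U)).
  set d := column_down _; set u := column_up _; set P := tiling_rest _.
  rewrite (eq_sym (left_word P)); case: (is_puzzle P); rewrite ?andbF //=.
  case: (top_word P == hs); rewrite ?andbF //=.
  case: (strip_ok d u); rewrite ?mulr0 //=.
  case: (_ == left_word P); rewrite ?andbF ?mulr0 //=.
  case: (edge_h _ == h) => /=; last by case: ifP; rewrite ?mul0r ?mulr0.
  by case: ifP; rewrite ?mulr0 // mul1r => _ /=; ring.
rewrite (sum_ffun_split (down_bij n) (fun d D => \sum_(U : {ffun up_pos n.+1 ->
  tile})
   Psi d D [ffun r => U (ufirst r)] [ffun u => U (ushift u)])).
under eq_bigr => d _ do under eq_bigr => D _ do
  rewrite (sum_ffun_split (up_bij n) (Psi d D)) exchange_big /=.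
rewrite exchange_big /=.
under eq_bigr => D _ do rewrite exchange_big /=.
rewrite pair_bigA /= enum_ordSl /= -map_comp.
transitivity (\sum_(P : tiling n) corner h l (fun a => strip (y ord0)
   [seq (y \o lift ord0) i | i <- enum 'I_n]
   (fun ka v => puzzle_term (y \o lift ord0) hs (fun vs => Xi (v :: vs)) ka P)
     a la)).
  apply: eq_bigr => -[D U] _; rewrite /Psi; set P := (D, U).
  rewrite /puzzle_term -/P; case: (boolP (is_puzzle P && _)) => [/andP[->
    ->]|nP]; last first.
    rewrite big1 => [|d _]; last by rewrite big1.
    rewrite corner_sum big1 // => t _.
    rewrite -[RHS](strip0 (y ord0) [seq (y \o lift ord0) i | i <- enum 'I_n]
      (edge_a t) la).
    by apply: eq_strip => ka v _; rewrite andbA (negbTE nP).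
  under eq_bigr => d _ do rewrite -big_distrr /=.
  rewrite -big_distrr /= /W.
  rewrite (strip_sum (y ord0) (y \o lift ord0) (fun t => (edge_h t == h)%:R)
    (fun v => Xi (v :: right_word P))) //;
      last by rewrite size_map size_enum_ord.
  rewrite corner_sum big_distrr /= [LHS]big_mkcondr [RHS]big_mkcondr.
  apply: eq_bigr => t _; case: (edge_b t == l) => //=.
  case: (edge_h t == h); last by rewrite mul0r mulr0.
  rewrite mul1r -stripZ; apply: eq_strip => ka v _; rewrite eq_sym.
  by case: ifP; rewrite ?mulr0.
transitivity (corner h l (fun a => \sum_(P : tiling n) strip (y ord0)
   [seq (y \o lift ord0) i | i <- enum 'I_n]
   (fun ka v => puzzle_term (y \o lift ord0) hs (fun vs => Xi (v :: vs)) ka P)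
     a la)).
  rewrite corner_sum; under eq_bigr => P _ do rewrite corner_sum.
  by rewrite exchange_big.
apply: eq_corner => a; rewrite -strip_bigsum; apply: eq_strip => ka v ska.
by rewrite IH // ska size_map size_enum_ord.
Qed.

End PuzzleSums.

(** * Laurent polynomials and specialization *)

Section LaurentFunctions.

Variable K : fieldType.

Definition nonzero N (v : 'I_N -> K) := forall i, v i != 0.

(** Laurent polynomial functions given by their syntax, which makes closure under operations and
    under renaming of variables immediate. [laurent_fun_eval] and [laurent_eval_fun] relate them to
    quotients p / 'X_[m]. *)
Inductive laurent_fun N : (('I_N -> K) -> K) -> Prop :=
| laurent_int (c : int) : laurent_fun (fun _ => c%:~R)
| laurent_var i : laurent_fun (fun v => v i)
| laurent_inv i : laurent_fun (fun v => (v i)^-1)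
| laurent_add f g : laurent_fun f -> laurent_fun g ->
    laurent_fun (fun v => f v + g v)
| laurent_mul f g : laurent_fun f -> laurent_fun g ->
    laurent_fun (fun v => f v * g v).

Lemma eq_laurent N (f g : ('I_N -> K) -> K) :
  f =1 g -> laurent_fun f -> laurent_fun g.
Proof. by move=> /functional_extensionality->. Qed.

Lemma laurent_nat N (c : nat) : laurent_fun (fun _ : 'I_N -> K => c%:R).
Proof. exact: (laurent_int _ c). Qed.

Lemma laurent_opp N (f : ('I_N -> K) -> K) :
  laurent_fun f -> laurent_fun (fun v => - f v).
Proof.
move=> lf; apply: eq_laurent (laurent_mul (laurent_int N (-1)) lf) => v.
by rewrite mulN1r.
Qed.

Lemma laurent_sum N (I : Type) (r : seq I) (P : pred I)
    (f : I -> ('I_N -> K) -> K) :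
  (forall i, laurent_fun (f i)) ->
  laurent_fun (fun v => \sum_(i <- r | P i) f i v).
Proof.
move=> lf; elim: r => [|i r IH].
  by apply: eq_laurent (laurent_nat N 0) => v; rewrite big_nil.
apply: (@eq_laurent _ (fun v => if P i then f i v + \sum_(j <- r | P j) f j v
                                else \sum_(j <- r | P j) f j v)).
  by move=> v; rewrite big_cons.
by case: (P i) => //; apply: laurent_add.
Qed.

Lemma laurent_prod N (I : Type) (r : seq I) (P : pred I)
    (f : I -> ('I_N -> K) -> K) :
  (forall i, laurent_fun (f i)) ->
  laurent_fun (fun v => \prod_(i <- r | P i) f i v).
Proof.
move=> lf; elim: r => [|i r IH].
  by apply: eq_laurent (laurent_nat N 1) => v; rewrite big_nil.
apply: (@eq_laurent _ (fun v => if P i then f i v * \prod_(j <- r | P j) f j v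
                                else \prod_(j <- r | P j) f j v)).
  by move=> v; rewrite big_cons.
by case: (P i) => //; apply: laurent_mul.
Qed.

Lemma laurent_exp N (f : ('I_N -> K) -> K) c :
  laurent_fun f -> laurent_fun (fun v => f v ^+ c).
Proof.
move=> lf; elim: c => [|c IH].
  by apply: eq_laurent (laurent_nat N 1) => v; rewrite expr0.
by apply: eq_laurent (laurent_mul lf IH) => v; rewrite exprS.
Qed.

Lemma laurent_comp N M (f : ('I_N -> K) -> K) (r : 'I_N -> 'I_M) :
  laurent_fun f -> laurent_fun (fun v => f (v \o r)).
Proof.
elim=> [c|i|i|g h _ lg _ lh|g h _ lg _ lh].
- exact: laurent_int.
- exact: laurent_var.
- exact: laurent_inv.
- exact: laurent_add.
- exact: laurent_mul.
Qed.

(** Shows that divided differences stay within Laurent polynomials. For products it is the twisted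
    Leibniz rule f h - f' h' = (f - f') h + f' (h - h'), the prime denoting the exchange. *)
Lemma laurent_divdiff N (f : ('I_N -> K) -> K) (a b : 'I_N) : laurent_fun f ->
  exists g, laurent_fun g /\ forall v, nonzero v ->
    f v - f (v \o tperm a b) = (v a - v b) * g v.
Proof.
elim=> [c|i|i|g h _ [g' [lg Eg]] lh [h' [lh' Eh]]|g h lg [g' [lg' Eg]] lh [h'
  [lh' Eh]]].
- exists (fun _ => 0%:R); split; first exact: laurent_nat.
  by move=> v _; rewrite subrr mulr0.
- have [->|ia] := eqVneq i a.
    exists (fun _ => 1%:R); split; first exact: laurent_nat.
    by move=> v _; rewrite /= tpermL mulr1.
  have [->|ib] := eqVneq i b.
    exists (fun _ => (-1)%:~R); split; first exact: laurent_int.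
    by move=> v _; rewrite /= tpermR mulrN1 opprB.
  exists (fun _ => 0%:R); split; first exact: laurent_nat.
  by move=> v _; rewrite /= tpermD 1?eq_sym // subrr mulr0.
- have [->|ia] := eqVneq i a.
    exists (fun v => - ((v a)^-1 * (v b)^-1)); split.
      by apply/laurent_opp/laurent_mul; apply: laurent_inv.
    by move=> v v0; rewrite /= tpermL; field; rewrite !v0.
  have [->|ib] := eqVneq i b.
    exists (fun v => (v a)^-1 * (v b)^-1); split.
      by apply/laurent_mul; apply: laurent_inv.
    by move=> v v0; rewrite /= tpermR; field; rewrite !v0.
  exists (fun _ => 0%:R); split; first exact: laurent_nat.
  by move=> v _; rewrite /= tpermD 1?eq_sym // subrr mulr0.
- exists (fun v => g' v + h' v); split; first exact: laurent_add.
  by move=> v v0; rewrite mulrDr -Eg // -Eh //; ring.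
exists (fun v => g' v * h v + g (v \o tperm a b) * h' v); split.
  apply: laurent_add; apply: laurent_mul => //.
  exact: (laurent_comp (tperm a b)).
move=> v v0; rewrite mulrDr mulrA -Eg // mulrCA -Eh //; ring.
Qed.

Lemma divdiff_quotient (a b h hs g : K) : a - b != 0 -> h - hs = (a - b) * g ->
  (a * h - b * hs) / (a - b) = h + b * g.
Proof.
move=> nab e; have -> : hs = h - (a - b) * g by rewrite -e opprB addrC subrK.
by field.
Qed.

End LaurentFunctions.

Section RationalFunctions.

Variables k n : nat.

Let K := ratfun k n.

Lemma mmap1_neq0 N (v : 'I_N -> K) m : nonzero v -> mmap1 v m != 0.
Proof. by move=> v0; apply/prodf_neq0 => i _; rewrite expf_neq0. Qed.

Lemma mmap1D N (v : 'I_N -> K) m1 m2 :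
  mmap1 v (m1 + m2) = mmap1 v m1 * mmap1 v m2.
Proof. by apply: commr_mmap1_M => i x; apply: mulrC. Qed.

Lemma mmap_mul N (v : 'I_N -> K) (p q : {mpoly int[N]}) :
  mmap intr v (p * q) = mmap intr v p * mmap intr v q.
Proof. exact: rmorphM. Qed.

Lemma laurent_fun_eval N (f : ('I_N -> K) -> K) : laurent_fun f ->
  exists p m, forall v, nonzero v -> f v = laurent_eval p m v.
Proof.
elim=> [c|i|i|g h _ [p [m E]] _ [p' [m' E']]|g h _ [p [m E]] _ [p' [m' E']]].
- exists c%:MP, 0%MM => v _.
  by rewrite /laurent_eval mmapC mmap11 divr1.
- exists 'X_i, 0%MM => v _.
  by rewrite /laurent_eval mmapX mmap1U mmap11 divr1.
- exists 1%:MP, U_(i)%MM => v _.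
  by rewrite /laurent_eval mmapC mmap1U div1r.
- exists (p * 'X_[m'] + p' * 'X_[m]), (m + m')%MM => v v0.
  rewrite E // E' // /laurent_eval mmapD !mmap_mul !mmapX mmap1D.
  by rewrite addf_div ?mmap1_neq0.
exists (p * p'), (m + m')%MM => v v0.
rewrite E // E' // /laurent_eval mmap_mul mmap1D.
by rewrite mulf_div.
Qed.

Lemma laurent_eval_fun N M (r : 'I_N -> 'I_M) (p : {mpoly int[N]}) m :
  laurent_fun (fun v : 'I_M -> K => laurent_eval p m (v \o r)).
Proof.
have l1 e : laurent_fun (fun v : 'I_M -> K => mmap1 (v \o r) e).
  by apply: laurent_prod => i; apply/laurent_exp/laurent_var.
have l2 e : laurent_fun (fun v : 'I_M -> K => (mmap1 (v \o r) e)^-1).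
  apply: (@eq_laurent _ _ (fun v => \prod_i ((v (r i))^-1 ^+ e i))).
    by move=> v; rewrite -prodfV; apply: eq_bigr => i _; rewrite exprVn.
  by apply: laurent_prod => i; apply/laurent_exp/laurent_inv.
apply: laurent_mul => //; rewrite /mmap; apply: laurent_sum => e.
by apply: laurent_mul => //; apply: laurent_int.
Qed.

Lemma concatl (x : 'I_k -> K) (y : 'I_n -> K) i : concat x y (lshift n i) = x i.
Proof. by rewrite /concat (unsplitK (inl i)). Qed.

Lemma concatr (x : 'I_k -> K) (y : 'I_n -> K) i : concat x y (rshift k i) = y i.
Proof. by rewrite /concat (unsplitK (inr i)). Qed.

Lemma concatP (Q : 'I_(k + n) -> Prop) :
  (forall i, Q (lshift n i)) -> (forall i, Q (rshift k i)) -> forall i, Q i.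
Proof. by move=> ql qr i; rewrite -(splitK i); case: (split i). Qed.

Lemma concat_neq0 (x : 'I_k -> K) (y : 'I_n -> K) :
  nonzero x -> nonzero y -> nonzero (concat x y).
Proof. by move=> x0 y0; apply: concatP => i; rewrite ?concatl ?concatr. Qed.

Lemma concat_XY i : concat (@X k n) (@Y k n) i = FracField.tofrac 'X_i.
Proof. by move: i; apply: concatP => i; rewrite ?concatl ?concatr. Qed.

Lemma mpolyXi_neq0 N (i : 'I_N) : 'X_i != 0 :> {mpoly int[N]}.
Proof.
apply/eqP => /(congr1 (fun p : {mpoly int[N]} => p@_U_(i))).
by rewrite mcoeffX eqxx mcoeff0.
Qed.

Lemma X_neq0 : nonzero (@X k n).
Proof. by move=> i; rewrite -(concatl _ (@Y k n)) concat_XY tofrac_eq0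
  mpolyXi_neq0. Qed.

Lemma Y_neq0 : nonzero (@Y k n).
Proof. by move=> i; rewrite -(concatr (@X k n)) concat_XY tofrac_eq0
  mpolyXi_neq0. Qed.

Lemma Y_inj : injective (@Y k n).
Proof.
move=> i j /eqP; rewrite tofrac_eq.
move=> /eqP/(congr1 (fun p : {mpoly int[k + n]} => p@_U_(rshift k i))).
rewrite !mcoeffX eqxx; case: eqP => // /(congr1 (fun m : 'X_{1..k + n} => m
  (rshift k i))).
by rewrite !mnm1E eqxx; case: eqP => // /rshift_inj ->.
Qed.

Lemma mmap_XY (p : {mpoly int[k + n]}) :
  mmap intr (concat (@X k n) (@Y k n)) p = FracField.tofrac p.
Proof.
rewrite [in RHS](mpolyE p) /mmap raddf_sum; apply: eq_bigr => m _ /=.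
rewrite -mul_mpolyC tofracM; congr (_ * _).
  by rewrite -[p@_m in RHS]intz !rmorph_int.
rewrite mpolyXE_id rmorph_prod /mmap1; apply: eq_bigr => i _.
by rewrite concat_XY rmorphXn.
Qed.

(** At the variables themselves evaluation is the embedding into the fraction field. Equality there
    is an identity of polynomials after clearing denominators, and can be evaluated at every nonzero
    tuple. *)
Lemma laurent_eval_generic p m p' m' :
  @laurent_eval k n (k + n) p m (concat (@X k n) (@Y k n))
  = laurent_eval p' m' (concat (@X k n) (@Y k n)) ->
  forall v : 'I_(k + n) -> K, nonzero v -> laurent_eval p m v = laurent_eval p'
    m' v.
Proof.
have XY0 := concat_neq0 X_neq0 Y_neq0.
move=> /eqP; rewrite /laurent_eval eqr_div ?mmap1_neq0 //.
rewrite -!(mmapX _ intr) -!mmap_mul !mmap_XY tofrac_eq => /eqP e v v0.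
by apply/eqP; rewrite eqr_div ?mmap1_neq0 // -!(mmapX _ intr) -!mmap_mul e.
Qed.

Definition laurentX (f : ('I_k -> K) -> K) : Prop :=
  exists h, laurent_fun h /\
    forall x, nonzero x -> f x = h (concat x (@Y k n)).

Lemma laurentX_specializes f (x : 'I_k -> K) : laurentX f -> nonzero x ->
  specializes (f (@X k n)) x (@Y k n) (f x).
Proof.
case=> h [lh Eh] x0; have [p [m E]] := laurent_fun_eval lh.
exists p, m; rewrite (Eh _ X_neq0) (Eh _ x0).
split; apply: E; first exact: concat_neq0 X_neq0 Y_neq0.
exact: concat_neq0 x0 Y_neq0.
Qed.

(** For an element given as a function of x, specialization is evaluation, so membership in the
    ideal can be tested on values. *)
Lemma specializes_uniq f (x : 'I_k -> K) g : laurentX f -> nonzero x ->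
  specializes (f (@X k n)) x (@Y k n) g -> g = f x.
Proof.
move=> lf x0; case: (laurentX_specializes lf x0) => p [m [E1 E2]] [p' [m' [E1'
  E2']]].
rewrite E2 E2'; apply: laurent_eval_generic; first by rewrite -E1 -E1'.
exact: concat_neq0 x0 Y_neq0.
Qed.

Lemma laurentX_add f g : laurentX f -> laurentX g -> laurentX (fun x => f x + g
  x).
Proof.
case=> h [lh Eh] [h' [lh' Eh']]; exists (fun v => h v + h' v).
by split=> [|x x0]; [apply: laurent_add | rewrite Eh // Eh'].
Qed.

Lemma laurentX_mul f g : laurentX f -> laurentX g -> laurentX (fun x => f x * g
  x).
Proof.
case=> h [lh Eh] [h' [lh' Eh']]; exists (fun v => h v * h' v).
by split=> [|x x0]; [apply: laurent_mul | rewrite Eh // Eh'].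
Qed.

Lemma laurentX_opp f : laurentX f -> laurentX (fun x => - f x).
Proof.
case=> h [lh Eh]; exists (fun v => - h v).
by split=> [|x x0]; [apply: laurent_opp | rewrite Eh].
Qed.

Lemma laurentX_sum (I : finType) (f : I -> ('I_k -> K) -> K) :
  (forall i, laurentX (f i)) -> laurentX (fun x => \sum_i f i x).
Proof.
move=> /fin_all_exists[h H]; exists (fun v => \sum_i h i v); split.
  by apply: laurent_sum => i; case: (H i).
by move=> x x0; apply: eq_bigr => i _; case: (H i) => _ ->.
Qed.

Lemma laurentX_const c : laurentY c -> laurentX (fun _ => c).
Proof.
case=> p [m ->]; exists (fun v => laurent_eval p m (v \o @rshift k n)); split.
  exact: laurent_eval_fun.
move=> x _; congr (laurent_eval p m _).
by apply: functional_extensionality => i; rewrite /= concatr.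
Qed.

(** The division in each step of the recursion is exact by [laurent_divdiff]. It can be carried out
    only at tuples [y] with distinct entries, hence the restriction. *)
Lemma Gup_laurent (l : {set 'I_n}) : exists h, laurent_fun h /\
  forall (x : 'I_k -> K) y, nonzero x -> nonzero y -> injective y ->
    Gup l x y = h (concat x y).
Proof.
elim/addable_ind: l => [l na|l i j ad IH].
  exists (fun v => \prod_(a < k) \prod_(j < n | (j < n - k)%N)
    (1%:R - v (lshift n a) * (v (rshift k j))^-1)); split.
    apply: laurent_prod => a; apply: laurent_prod => j.
    apply: laurent_add; first exact: laurent_nat.
    apply/laurent_opp/laurent_mul; [exact: laurent_var | exact: laurent_inv].
  move=> x y _ _ _; rewrite Gup_noadd //; apply: eq_bigr => a _;
    apply: eq_bigr => j _.
  by rewrite concatl concatr.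
have [|h [lh Eh]] := IH (move l i j); first by rewrite [X in (_ <
  X)%N](codepth_move ad).
have [g [lg Eg]] := laurent_divdiff (rshift k i) (rshift k j) lh.
exists (fun v => h v + v (rshift k j) * g v); split.
  by apply: laurent_add => //; apply: laurent_mul => //; apply: laurent_var.
move=> x y x0 y0 yi.
have v0 := concat_neq0 x0 y0.
have ys0 : nonzero (y \o tperm i j) by move=> a; apply: y0.
rewrite (Gup_add _ _ ad) /divdiff (Eh _ _ x0 y0 yi).
rewrite (Eh _ _ x0 ys0 (inj_tperm yi)).
have -> : concat x (y \o tperm i j)
    = concat x y \o tperm (rshift k i) (rshift k j).
  apply: functional_extensionality; apply: concatP => a /=;
    rewrite ?concatl ?concatr.
    by rewrite tpermD ?concatl // eq_rlshift.
  case: (tpermP i j a) => [->|->|ai aj].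
  - by rewrite !tpermL concatr /= tpermL.
  - by rewrite !tpermR concatr /= tpermR.
  rewrite /= !tpermD ?concatr ?(inj_eq (@rshift_inj _ _)) 1?eq_sym //;
    exact/eqP.
have [/eqP ij _ _] := and3P ad; rewrite /= in ij.
have nij : y i - y j != 0.
  by rewrite subr_eq0; apply/eqP => /yi /(congr1 val) /= e; move: ij;
    rewrite e; lia.
by have := Eg _ v0; rewrite !concatr => /(divdiff_quotient nij).
Qed.

Lemma Gup_perm (l : {set 'I_n}) (x : 'I_k -> K) (y : 'I_n -> K) (s : 'S_k) :
  Gup l (x \o s) y = Gup l x y.
Proof.
elim/addable_ind: l y => [l na|l i j ad IH] y.
  by rewrite !Gup_noadd // /Gtop [RHS](reindex_inj (@perm_inj _ s)).
rewrite !(Gup_add _ _ ad); apply: divdiff_ext => z; apply: IH.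
by rewrite [X in (_ < X)%N](codepth_move ad).
Qed.

Lemma Gdown_perm (l : {set 'I_n}) (x : 'I_k -> K) (y : 'I_n -> K) (s : 'S_k) :
  Gdown l (x \o s) y = Gdown l x y.
Proof.
rewrite /Gdown Gup_perm; congr (_ * _ * _).
by rewrite [RHS](reindex_inj (@perm_inj _ s)).
Qed.

Lemma Gdown_laurentX (l : {set 'I_n}) (r : 'I_n -> 'I_n) : injective r ->
  laurentX (fun x => Gdown l x (@Y k n \o r)).
Proof.
move=> ri; have [h [lh Eh]] := Gup_laurent (conj_frame l).
pose q (i : 'I_(k + n)) : 'I_(k + n) :=
  match split i with inl a => lshift n a | inr b => rshift k (r (rev_ord b))
    end.
exists (fun v => (\prod_(i < k) v (lshift n i))
  * (\prod_(i in l) (v (rshift k (r i)))^-1) * h (v \o q)); split.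
  apply: laurent_mul; last exact: laurent_comp.
  apply: laurent_mul; apply: laurent_prod => i;
    [exact: laurent_var | exact: laurent_inv].
move=> x x0; rewrite /Gdown; congr (_ * _ * _).
- by apply: eq_bigr => i _; rewrite concatl.
- by apply: eq_bigr => i _; rewrite concatr.
have z0 : nonzero ((@Y k n \o r) \o @rev_ord n) by move=> i; apply: Y_neq0.
have zi : injective ((@Y k n \o r) \o @rev_ord n).
  exact: inj_comp (inj_comp Y_inj ri) rev_ord_inj.
rewrite (Eh _ _ x0 z0 zi).
  congr h; apply: functional_extensionality => i /=; rewrite /q /concat.
  by case: (split i) => a; rewrite ?(unsplitK (inl a)) ?(unsplitK (inr (r
    (rev_ord a)))).
Qed.

Lemma puzzle_sum_laurentY lam mu nu : laurentY (puzzle_sum (@Y k n) lam mu nu).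
Proof.
have : laurent_fun (fun v : 'I_n -> K => puzzle_sum v lam mu nu).
  apply: laurent_sum => P; apply: laurent_prod => u; apply: laurent_prod => v.
  rewrite /lozenge_weight /lozenge_param.
  have lp : laurent_fun (fun y : 'I_n -> K => y (ucol u) / y (Ordinal (svalP
    u))).
    by apply: laurent_mul; [apply: laurent_var | apply: laurent_inv].
  case: (_ == (tG2, tG1)); first exact: lp.
  case: (_ == (tR1, tR2)); first exact: lp.
  case: (_ == (tQ, tQ)).
    exact: laurent_add (laurent_nat _ _ 1) (laurent_opp lp).
  case: (_ == (tK, tE)); first exact: laurent_int _ (-1).
  exact: laurent_nat _ _ 1.
case/laurent_fun_eval => p [m E]; exists p, m; apply: E; exact: Y_neq0.
Qed.

End RationalFunctions.

(** * From words to Young diagrams *)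

Section FramesAndWords.

Variable F : fieldType.

Lemma generic_tab n (y : 'I_n -> F) :
  injective y -> (forall i, y i != 0) -> generic (tab y).
Proof.
move=> yi y0; rewrite /generic (map_inj_uniq yi) enum_uniq all_map.
by apply/allP => i _ /=.
Qed.

Lemma mem_conj n (l : {set 'I_n}) i : (i \in conj_frame l) = (rev_ord i \in l).
Proof.
apply/imsetP/idP => [[j jl ->]|il]; first by rewrite rev_ordK.
by exists (rev_ord i) => //; rewrite rev_ordK.
Qed.

Lemma conj_frameK n : involutive (@conj_frame n).
Proof. by move=> l; apply/setP => i; rewrite !mem_conj rev_ordK. Qed.

Lemma card_conj n (l : {set 'I_n}) : #|conj_frame l| = #|l|.
Proof. exact/card_imset/rev_ord_inj. Qed.

Lemma Hword_tab k n (x : 'I_k -> F) (y : 'I_n -> F) (l : {set 'I_n}) :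
  #|l| = k -> Hword x (tab y) (tab (fun i => i \in l)) = Hup l x y.
Proof.
move=> lk.
have el : [set i : 'I_n | nth false (tab (fun i => i \in l)) i] = l.
  by apply/setP => i; rewrite inE nth_tab.
rewrite (@HwordE _ _ n) ?size_tab //; last first.
  by rewrite -(@card_word n) ?size_tab // el.
rewrite el; congr (Hup l x _).
by apply: functional_extensionality => i; rewrite nth_tab.
Qed.

Lemma Gdown_Hup k n (l : {set 'I_n}) (x : 'I_k -> F) (y : 'I_n -> F) :
  Gdown l x y = Hup (conj_frame l) x (y \o @rev_ord n).
Proof.
rewrite /Gdown /Hup; congr (_ * _ * _).
rewrite (reindex_inj rev_ord_inj) /=.
by apply: eq_bigl => i; rewrite mem_conj.
Qed.

Lemma rev_ord_comp2 n (y : 'I_n -> F) : (y \o @rev_ord n) \o @rev_ord n = y.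
Proof. by apply: functional_extensionality => i /=; rewrite rev_ordK. Qed.

(** All three words follow the lines y_1, ..., y_n; the top and the right side are read in the
    opposite order in the boundary conditions, hence [rev_ord]. *)
Definition left_letters n (l : {set 'I_n}) := tab (fun i => if i \in l then O
  else R).
Definition top_letters n (l : {set 'I_n}) :=
  tab (fun i => if rev_ord i \in l then G else R).
Definition right_letters n (l : {set 'I_n}) :=
  tab (fun i => if rev_ord i \in l then G else O).

Lemma Hleft_Gdown k n (l : {set 'I_n}) (x : 'I_k -> F) (y : 'I_n -> F) :
  #|l| = k -> Hleft x (tab y) (left_letters l) = Gdown l x y.
Proof.
move=> lk; rewrite /Hleft.
have -> : all left_state (left_letters l).
  by rewrite /left_letters /tab all_map; apply/allP => i _ /=; case: (i \in l).
rewrite map_tab !rev_tab Gdown_Hup -Hword_tab ?card_conj //.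
by congr Hword; apply: eq_tab => i; rewrite /= mem_conj; case: (_ \in l).
Qed.

Lemma Htop_Gdown k n (l : {set 'I_n}) (x : 'I_k -> F) (y : 'I_n -> F) :
  #|l| = k ->
  Hword x (tab y) [seq s == G | s <- top_letters l] = Gdown l x (y \o @rev_ord
    n).
Proof.
move=> lk; rewrite map_tab Gdown_Hup rev_ord_comp2 -Hword_tab ?card_conj //.
by congr Hword; apply: eq_tab => i; rewrite /= mem_conj; case: (_ \in l).
Qed.

Lemma Hright_Gdown k n (l : {set 'I_n}) (x : 'I_k -> F) (y : 'I_n -> F) :
  #|l| = k ->
  Hright x (tab y) (right_letters l) = Gdown l x (y \o @rev_ord n).
Proof.
move=> lk; rewrite /Hright.
have -> : all right_state (right_letters l).
  by rewrite /right_letters /tab all_map; apply/allP => i _ /=;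
    case: (rev_ord i \in l).
rewrite map_tab Gdown_Hup rev_ord_comp2 -Hword_tab ?card_conj //.
by congr Hword; apply: eq_tab => i; rewrite /= mem_conj; case: (_ \in l).
Qed.

Lemma right_letters_inj n : injective (@right_letters n).
Proof.
move=> l l' /tab_inj e; apply/setP => i; have := e (rev_ord i);
  rewrite rev_ordK.
by case: (i \in l); case: (i \in l').
Qed.

(** At most one [nu] has the word [vs]; if there is none, then a letter or the weight of [vs] is
    wrong and [Hright] is 0 by convention. *)
Lemma Hright_expand k n (x : 'I_k -> F) (y : 'I_n -> F) vs : size vs = n ->
  Hright x (tab y) vs
  = \sum_(nu : diagram k n | vs == right_letters (frame nu))
      Gdown (frame nu) x (y \o @rev_ord n).
Proof.
move=> sv; case: (pickP (fun nu : diagram k n => vs == right_letters (frame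
  nu)))
  => [nu /eqP e|no].
  rewrite e (big_pred1 nu) ?Hright_Gdown //; first exact/eqP/(svalP nu).
  move=> nu'; rewrite /= eq_sym; apply/eqP/eqP =>
    [/right_letters_inj/val_inj->//|->//].
rewrite big_pred0 // /Hright; case: ifP => // rs; rewrite /Hword.
case: ifP => // /andP[_ /eqP ck].
pose l := [set i : 'I_n | nth O vs (rev_ord i) == G].
have vl : vs = right_letters l.
  rewrite (tab_nth O sv); apply: eq_tab => i; rewrite inE rev_ordK.
  have := allP rs _ (mem_nth O (_ : (i < size vs)%N)).
  by rewrite sv => /(_ (ltn_ord i)) /orP[] /eqP->.
have lk : #|l| == k.
  rewrite -card_conj -ck -(@card_word n) ?size_map //; apply/eqP.
  apply: eq_card => i; rewrite mem_conj !inE rev_ordK.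
  by rewrite (nth_map O) // sv.
by have := no (exist _ l lk); rewrite -vl eqxx.
Qed.

Lemma has_boundary_words n (lam mu nu : {set 'I_n}) (P : tiling n) :
  has_boundary lam mu nu P
  = [&& top_word P == top_letters mu, left_word P == left_letters lam &
        right_word P == right_letters nu].
Proof.
apply/forallP/and3P => [H|[/eqP Ht /eqP Hl /eqP Hr] v].
  split; apply/eqP; apply: eq_tab => i.
  - by have /and3P[_ /implyP/(_ isT)/eqP] := H (tpos i).
  - by have /and3P[/implyP/(_ isT)/eqP] := H (lpos i).
  have /and3P[_ _ /implyP h] := H (rpos i); apply/eqP/h.
  by rewrite /drow /dcol /= subnK.
apply/and3P; split; apply/implyP => /eqP e; apply/eqP.
- have -> : v = lpos (drow v) by apply: down_pos_inj.
  exact: (tab_inj Hl (drow v)).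
- have -> : v = tpos (dcol v) by apply: down_pos_inj.
  exact: (tab_inj Ht (dcol v)).
have er : drow v = rev_ord (dcol v) by apply: val_inj => /=; lia.
have -> : v = rpos (dcol v) by apply: down_pos_inj; rewrite // er.
exact: (tab_inj Hr (dcol v)).
Qed.

Lemma puzzle_product k n (lam mu : diagram k n) (y : 'I_n -> F) (I : 'I_k ->
  'I_n) :
  injective y -> (forall i, y i != 0) ->
  (forall a b : 'I_k, (a < b)%N -> (I a < I b)%N) ->
  Gdown (frame lam) (y \o I) y * Gdown (frame mu) (y \o I) (y \o @rev_ord n)
  = \sum_(nu : diagram k n) puzzle_sum y (frame lam) (frame mu) (frame nu)
            * Gdown (frame nu) (y \o I) (y \o @rev_ord n).
Proof.
move=> yi y0 mono.
have lk : #|frame lam| = k by apply/eqP/(svalP lam).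
have mk : #|frame mu| = k by apply/eqP/(svalP mu).
rewrite -Hleft_Gdown // -Htop_Gdown //.
rewrite (@product_rule_mono _ _ _ _ I) //; last first.
- by rewrite !size_tab.
- by rewrite !size_tab.
- by rewrite /top_letters /tab all_map; apply/allP => i _ /=; case: (_ \in _).
- by rewrite /left_letters /tab all_map; apply/allP => i _ /=; case: (_ \in _).
- by move=> a; rewrite nth_tab.
- by move=> a; rewrite size_tab.
- exact: generic_tab.
rewrite -puzzle_sum_puz ?size_tab //.
under [RHS]eq_bigr => nu _ do rewrite big_distrl /=.
under [RHS]eq_bigr => nu _ do rewrite big_mkcond /=.
rewrite exchange_big /=; apply: eq_bigr => P _.
rewrite /puzzle_term (Hright_expand _ _ (size_tab _)).
under [RHS]eq_bigr => nu _ do rewrite has_boundary_words.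
case: (is_puzzle P) => /=; last by rewrite big1.
case: (_ == top_letters _) => /=; last by rewrite big1.
case: (_ == left_letters _) => /=; last by rewrite big1.
by rewrite -big_mkcond big_distrr.
Qed.

(** The matrix is block triangular in the first letter. Points using the first variable see only
    words starting with [true]. Once these coefficients are known to vanish, the other points see
    the words starting with [false], up to a nonzero factor. *)
Lemma Hword_free k n ys (c : seq bool -> F) : generic ys -> size ys = n ->
  (forall I : 'I_k -> nat, (forall a b : 'I_k, (a < b)%N -> (I a < I b)%N) ->
     (forall a, (I a < n)%N) ->
     \sum_(b : {ffun 'I_n -> bool})
       c (tab b) * Hword (fun a => nth 0 ys (I a)) ys (tab b) = 0) ->
  forall bs, size bs = n -> count id bs = k -> c bs = 0.
Proof.
elim: ys n k c => [|y ys IH] n k c.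
  case: k => [|k] ge <- H [|//] // _ _.
  have I0 : 'I_0 -> nat by case.
  have := H I0; rewrite (sum_ffun0 _ [ffun => false]) /tab enum_ord0 /=.
  by rewrite Hword0 /= mulr1; apply; case.
case: n => // n ge [sy] H; have [y0 yn ge'] : [/\ y != 0, y \notin ys & generic
  ys].
  by apply/and3P; rewrite -generic_cons.
have split_sum (Phi : seq bool -> F) : \sum_(b : {ffun 'I_n.+1 -> bool}) Phi
  (tab b)
  = \sum_(b : {ffun 'I_n -> bool}) Phi (true :: tab b)
    + \sum_(b : {ffun 'I_n -> bool}) Phi (false :: tab b).
  transitivity (\sum_(b : {ffun 'I_n.+1 -> bool})
    (fun t (d : {ffun 'I_n -> bool}) => Phi (t :: tab d))
      (b ord0) [ffun i => b (lift ord0 i)]).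
    apply: eq_bigr => b _; rewrite tabS; congr (Phi (_ :: _)).
    by apply: eq_tab => i; rewrite /= ffunE.
  by rewrite (sum_ffunS (fun t (d : {ffun 'I_n -> bool}) => Phi (t :: tab d)))
    big_bool.
have inc bs : size bs = n -> (count id bs).+1 = k -> c (true :: bs) = 0.
  case: k H => // k H sb [cb]; apply: (IH n k (fun bs => c (true :: bs)) ge' sy
    _ bs sb cb) => I mono IS.
  (* The point with first coordinate [y], where words starting with [false] have value 0. *)
  pose I' (a : 'I_k.+1) := if unlift ord0 a is Some b then (I b).+1 else 0%N.
  have := H I'; rewrite (split_sum (fun bs =>
    c bs * Hword (fun a => nth 0 (y :: ys) (I' a)) (y :: ys) bs)).
  rewrite [X in _ + X]big1 ?addr0 => [|b _]; last first.
    by rewrite Hword_out0 ?mulr0 // /I' unlift_none.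
  move=> H'; rewrite -[RHS]H'.
  - apply: eq_bigr => b _; rewrite Hword_in // /I' ?unlift_none //;
    congr (_ * Hword _ _ _).
    by apply: functional_extensionality => a; rewrite /= liftK.
  - move=> a b; rewrite /I'; case: unliftP => [a'|] ->;
    case: unliftP => [b'|] -> //.
    by rewrite /= /bump /= !add1n !ltnS; apply: mono.
  - by move=> a; rewrite /I'; case: unliftP => [a'|] // _; rewrite /= ltnS.
case=> [//|[] bs] [sb] /= cb; first exact: inc.
apply: (IH n k (fun bs => c (false :: bs)) ge' sy _ bs sb cb) => I mono IS.
have := H (fun a => (I a).+1) mono IS; rewrite (split_sum (fun bs =>
  c bs * Hword (fun a => nth 0 (y :: ys) (I a).+1) (y :: ys) bs)).
rewrite [X in X + _]big1 ?add0r => [|b _]; last first.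
  have [e|e] := eqVneq (count id (true :: tab b)) k.
    by rewrite inc ?mul0r ?size_tab // -e.
  by rewrite /Hword (negbTE e) andbF mulr0.
under eq_bigr => b _ do rewrite Hword_out mulrCA.
rewrite -big_distrr /= => /eqP; rewrite mulf_eq0 => /orP[|/eqP //].
(* The common factor is nonzero: otherwise [y] would occur again among [ys]. *)
rewrite prodf_seq_eq0 => /hasP[a _ /=]; rewrite subr_eq0 => /eqP e.
case/negP: yn; have -> : y = nth 0 ys (I a); last by rewrite mem_nth ?sy.
by rewrite -[y]mul1r e divfK.
Qed.

Lemma Gdown_free k n (c : diagram k n -> F) (y : 'I_n -> F) :
  injective y -> (forall i, y i != 0) ->
  (forall I : 'I_k -> 'I_n, (forall a b : 'I_k, (a < b)%N -> (I a < I b)%N) ->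
     \sum_(nu : diagram k n) c nu * Gdown (frame nu) (y \o I) (y \o @rev_ord n)
       = 0) ->
  forall nu, c nu = 0.
Proof.
move=> yi y0 H nu.
pose w (nu : diagram k n) := tab (fun i => i \in conj_frame (frame nu)).
have w_inj : injective w.
  move=> a b /tab_inj e; apply: val_inj; rewrite -[LHS]conj_frameK
    -[RHS]conj_frameK.
  by congr conj_frame; apply/setP.
(* The coefficients carried over to words, with 0 at those that come from no diagram. *)
pose c' bs := \sum_(nu | w nu == bs) c nu.
have cw : c' (w nu) = c nu.
  by rewrite /c' (big_pred1 nu) // => nu'; rewrite (inj_eq w_inj).
rewrite -cw; apply: (@Hword_free k n (tab y) c'); rewrite ?size_tab //;
  last first.
- rewrite -(@card_word n) ?size_tab //.
  have -> : [set i : 'I_n | nth false (w nu) i] = conj_frame (frame nu).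
    by apply/setP => i; rewrite inE nth_tab.
  by rewrite card_conj; apply/eqP/(svalP nu).
- move=> I mono IS; pose J (a : 'I_k) := Ordinal (IS a).
  rewrite -[RHS](H J mono) /c'.
  under eq_bigr => b _ do rewrite big_distrl big_mkcond /=.
  rewrite exchange_big; apply: eq_bigr => nu' _.
  rewrite -big_mkcond (big_pred1 [ffun i => i \in conj_frame (frame nu')]).
    rewrite (@eq_tab _ _ [ffun i => _] (fun i => i \in conj_frame (frame nu'))).
      rewrite Gdown_Hup rev_ord_comp2 -Hword_tab; last first.
        by rewrite card_conj; apply/eqP/(svalP nu').
      congr (_ * Hword _ _ _); apply: functional_extensionality => a.
      by rewrite -[I a]/(nat_of_ord (J a)) nth_tab.
    by move=> i; rewrite ffunE.
  move=> b /=; apply/eqP/eqP => [/tab_inj e|->].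
    by apply/ffunP => i; rewrite ffunE e.
  by apply: eq_tab => i; rewrite ffunE.
- exact: generic_tab.
Qed.

End FramesAndWords.

(** * Equality of classes and the product formula *)

Section Classes.

Variables k n : nat.

Let K := ratfun k n.

Lemma KT_ring_laurentX f : laurentX f ->
  (forall (x : 'I_k -> K) (s : 'S_k), f (x \o s) = f x) ->
  KT_ring (f (@X k n)).
Proof.
move=> lf fs s; rewrite -{2}(fs (@X k n) s).
by apply: laurentX_specializes => // i; apply: X_neq0.
Qed.

(** Symmetry in x and the Laurent property put both functions in the ring; what is left of equality
    of classes is agreement at the fixed points. *)
Lemma KT_eq_laurentX f g : laurentX f -> laurentX g ->
  (forall (x : 'I_k -> K) (s : 'S_k), f (x \o s) = f x) ->
  (forall (x : 'I_k -> K) (s : 'S_k), g (x \o s) = g x) ->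
  KT_eq (f (@X k n)) (g (@X k n)) <->
  (forall I : 'I_k -> 'I_n, (forall a b : 'I_k, (a < b)%N -> (I a < I b)%N) ->
     f (@Y k n \o I) = g (@Y k n \o I)).
Proof.
move=> lf lg fs gs.
have lfg := laurentX_add lf (laurentX_opp lg).
have fgs (x : 'I_k -> K) (s : 'S_k) : f (x \o s) - g (x \o s) = f x - g x.
  by rewrite fs gs.
have YI0 (I : 'I_k -> 'I_n) : nonzero (@Y k n \o I).
  by move=> a; apply: Y_neq0.
split=> [[_ _ [_ H]] I mono|H].
  have := specializes_uniq lfg (YI0 I) (H I mono).
  by move/esym/eqP; rewrite subr_eq0 => /eqP.
split; [exact: KT_ring_laurentX | exact: KT_ring_laurentX | split].
  exact: (KT_ring_laurentX lfg fgs).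
move=> I mono; have <- : f (@Y k n \o I) - g (@Y k n \o I) = 0.
  by rewrite H // subrr.
exact: (laurentX_specializes lfg (YI0 I)).
Qed.

End Classes.

Theorem theorem3 (k n : nat) (hk : (k <= n)%N) (hn : (0 < n)%N)
    (lam mu : diagram k n) (d : diagram k n -> ratfun k n) :
  is_structure_coeffs lam mu d <->
  (forall nu : diagram k n,
     d nu = puzzle_sum (@Y k n) (frame lam) (frame mu) (frame nu)).
Proof.
pose f (x : 'I_k -> ratfun k n) :=
  Gdown (frame lam) x (@Y k n) * Gdown (frame mu) x (@revY k n).
pose g (x : 'I_k -> ratfun k n) :=
  \sum_nu d nu * Gdown (frame nu) x (@revY k n).
have lf : laurentX f.
  apply: laurentX_mul.
    exact: (@Gdown_laurentX k n (frame lam) id (@inj_id _)).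
  exact: (@Gdown_laurentX k n (frame mu) (@rev_ord n) (@rev_ord_inj n)).
have fs x (s : 'S_k) : f (x \o s) = f x by rewrite /f !Gdown_perm.
have gs x (s : 'S_k) : g (x \o s) = g x.
  by apply: eq_bigr => nu _; rewrite Gdown_perm.
(* The Laurent property of the [d nu] is part of the definition in one direction and comes from
   [puzzle_sum_laurentY] in the other. *)
have lg : (forall nu, laurentY (d nu)) -> laurentX g.
  move=> ld; apply: laurentX_sum => nu; apply: laurentX_mul.
    exact: laurentX_const.
  exact: (@Gdown_laurentX k n (frame nu) (@rev_ord n) (@rev_ord_inj n)).
have fP I := @puzzle_product (ratfun k n) k n lam mu (@Y k n) I (@Y_inj k n)
  (@Y_neq0 k n).
split=> [[ld H]|H].
  have E := (KT_eq_laurentX lf (lg ld) fs gs).1 H.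
  move=> nu; apply/eqP; rewrite -subr_eq0; apply/eqP; move: nu.
  apply: (Gdown_free (@Y_inj k n) (@Y_neq0 k n)) => I mono.
  under eq_bigr => nu _ do rewrite mulrBl.
  rewrite sumrB -(fP I mono); apply/eqP; rewrite subr_eq0; apply/eqP.
  exact: esym (E I mono).
have ld nu : laurentY (d nu) by rewrite H; apply: puzzle_sum_laurentY.
split=> //; apply/(KT_eq_laurentX lf (lg ld) fs gs) => I mono.
by rewrite /f (fP I mono); apply: eq_bigr => nu _; rewrite H.
Qed.
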